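(* Let $m\in\mathbb{N}_0=\{0,1,2,\dotsc\}$, $a\in\mathbb{C}$, and $z\in\mathbb{C}\setminus\bigl((-\infty,-1]\cup[1,\infty)\bigr)$. Then $$ {}_2F_1\Bigl(a,a+\frac{1}{2};\frac{1}{2}-m;z^2\Bigr) =\frac{1}{2^{m+1}}\frac{m!}{(2m-1)!!}\sum_{k=0}^m\frac{2^k}{k!}\binom{2m-2k}{m-k}\sum_{\ell=0}^{k}(2k-2\ell-1)!!\binom{2k-\ell-1}{\ell-1}\bigl[(2a)_\ell(1+z)^{-2a-\ell}+\langle-2a\rangle_\ell(1-z)^{-2a-\ell}\bigr]z^\ell. $$
   Context: The Gauss hypergeometric function is ${}_2F_1(a,b;c;x)=\sum_{j=0}^\infty\frac{(a)_j(b)_j}{(c)_j}\frac{x^j}{j!}$ for $|x|<1$, $c\notin\{0,-1,-2,\dotsc\}$, and it extends to a single-valued analytic function of $x\in\mathbb{C}\setminus[1,\infty)$. Rising factorial: $(x)_k=x(x+1)\dotsm(x+k-1)$, $(x)_0=1$. Falling factorial: $\langle x\rangle_k=x(x-1)\dotsm(x-k+1)$, $\langle x\rangle_0=1$. Double factorials: $(2r-1)!!=1\cdot3\dotsm(2r-1)$ for $r\ge1$ and $(-1)!!=1$. Extended binomial coefficients: for integer $w\ge0$, $\binom{x}{w}=\frac{x(x-1)\dotsm(x-w+1)}{w!}$; for integer $w<0$ and $x$ not a negative integer, $\binom{x}{w}=0$; and $\binom{-1}{-1}=1$. (Thus $\binom{2k-\ell-1}{\ell-1}$ equals $1$ for $k=\ell=0$,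 and equals $0$ for $k\ge1$, $\ell=0$.) Complex powers $(1\pm z)^s$ are principal values. The convention $z^0=1$ is used. *)

(* Defs.v *)
From mathcomp Require Import all_boot all_order all_algebra.
From mathcomp Require Import complex.
From mathcomp Require Import all_classical all_reals all_analysis.
Set Implicit Arguments.
Unset Strict Implicit.
Unset Printing Implicit Defensive.
Import Order.TTheory GRing.Theory Num.Theory.
Import numFieldNormedType.Exports.
Local Open Scope classical_set_scope.
Local Open Scope ring_scope.
Local Open Scope complex_scope.

(* (2r-1)!! = 1 * 3 * ... * (2r-1), indexed by r; equal to 1 for r = 0. *)
Definition odd_dfact (r : nat) : nat := (\prod_(i < r) (2 * i + 1))%N.

Section NumField.
Variable K : numFieldType.
Implicit Types (a b c x : K) (f : K -> K).

Definition rising x (n : nat) : K := \prod_(i < n) (x + i%:R).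

Definition falling x (n : nat) : K := \prod_(i < n) (x - i%:R).

(* For w < 0 the coefficient is meant to be used only when x is not a negative
   integer, or when x = w = -1. *)
Definition ebinom x (w : int) : K :=
  match w with
  | Posz n => falling x n / n`!%:R
  | Negz _ => if (x == -1) && (w == -1) then 1 else 0
  end.

Definition analytic_at f x0 : Prop :=
  exists u : nat -> K, \forall x \near x0,
    series (fun n => u n * (x - x0) ^+ n) @ \oo --> f x.

Definition hyp2F1_coef a b c (j : nat) : K :=
  rising a j * rising b j / rising c j / j`!%:R.

(* Used with K = R[i], where x <= y holds iff 'Im x = 'Im y and 'Re x <= 'Re y,
   so that `[1, +oo[ is the half-line [1, oo) of the real axis. *)
Definition is_hyp2F1 a b c f : Prop :=
  (forall x, `|x| < 1 ->
     series (fun j => hyp2F1_coef a b c j * x ^+ j) @ \oo --> f x) /\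
  (forall x, x \notin `[1, +oo[ -> analytic_at f x).

(* The function satisfying is_hyp2F1, which over R[i] is determined on the
   complement of [1, oo); the default value 0 of xget is reached only if there
   is no such function. *)
Definition hyp2F1 a b c : K -> K := xget (fun=> 0) [set f | is_hyp2F1 a b c f].

End NumField.

Section ComplexPower.
Variable R : realType.
Implicit Types z w s : R[i].

Definition cexp z : R[i] :=
  (expR (complex.Re z))%:C * (cos (complex.Im z) +i* sin (complex.Im z)).

(* Principal argument, in ]-pi, pi]; meaningful for z != 0 only. *)
Definition carg z : R :=
  let t := acos (complex.Re z / complex.Re `|z|) in
  if 0 <= complex.Im z then t else - t.

Definition clog z : R[i] := ln (complex.Re `|z|) +i* carg z.

Definition cpow w s : R[i] := cexp (s * clog w).

End ComplexPower.

(* Main.v *)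
(* Put q_(k,l) = (2k-2l-1)!! binom(2k-l-1, l-1) and y = 2j.  On |z| < 1, expanding
   (1 +- z)^(-2a-l) by the binomial series turns the theorem into an identity
   between the coefficients of z^(2j), and it splits into
     sum_l (-1)^l q_(k,l) <y>_l = 2^k (-y/2)_k
   and the Vandermonde convolution of (-y/2)_k with
   (1/2)_(m-k) = (m-k)! binom(2m-2k, m-k) / 4^(m-k), whose value is ((1-y)/2)_m.
   The right-hand side G is even in z, so w |-> G(sqrt w) does not depend on the
   branch of the root; composing power series shows that it is analytic off
   [1, oo), and the identity theorem along the segments from 0, which stay off
   [1, oo), identifies it with the continued hypergeometric function. *)
Require Import Defs.
From mathcomp Require Import all_boot all_order all_algebra.
From mathcomp Require Import complex.
From mathcomp Require Import all_classical all_reals all_analysis.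
From mathcomp Require Import ring lra zify.
Import Order.TTheory GRing.Theory Num.Theory.
Import numFieldNormedType.Exports.
Import Normc.
Local Open Scope classical_set_scope.
Local Open Scope ring_scope.
Local Open Scope complex_scope.
Set Implicit Arguments.
Unset Strict Implicit.
Unset Printing Implicit Defensive.

(** [hyp2F1] is a choice among the functions satisfying [is_hyp2F1], so nothing can be said of its
    values before one such function is exhibited. The closed form itself, evaluated at a square
    root, is that witness, and uniqueness then transfers its values. [analytic_at] records only
    convergence of a power series near a point, a form that does not compose. Analyticity is
    therefore established in the stronger form [psum f r M], where [M] bounds the weighted l1 norm
    of the coefficients at radius [r]. That norm is subadditive and submultiplicative, so sums,
    products and compositions come with explicit bounds. Complex differentiation is avoided: the
    binomial series is obtained from a linear differential equation in a real parameter along the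
    segment from [1] to [1 + t], handled on real and imaginary parts. *)

(** * Rising and falling factorials and the finite sums behind the coefficient identity *)

Section Combinatorics.
Variable K : numFieldType.
Implicit Types (x y a : K).

Lemma rising0 x : rising x 0 = 1.
Proof. by rewrite /rising big_ord0. Qed.

Lemma risingSr x n : rising x n.+1 = rising x n * (x + n%:R).
Proof. by rewrite /rising big_ord_recr. Qed.

Lemma risingSl x n : rising x n.+1 = x * rising (x + 1) n.
Proof.
rewrite /rising big_ord_recl/= addr0; congr (_ * _); apply: eq_bigr => i _.
by rewrite /bump/= add1n -natr1; ring.
Qed.

Lemma risingD x m n : rising x (m + n) = rising x m * rising (x + m%:R) n.
Proof.
elim: n => [|n IH]; first by rewrite addn0 rising0 mulr1.
by rewrite addnS !risingSr IH natrD; ring.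
Qed.

Lemma rising1 n : rising (1 : K) n = n`!%:R.
Proof.
elim: n => [|n IH]; first by rewrite rising0.
by rewrite risingSr IH factS natrM nat1r mulrC.
Qed.

Lemma falling_rising x n : falling (- x) n = (-1) ^+ n * rising x n.
Proof.
elim: n => [|n IH]; first by rewrite /falling rising0 big_ord0 expr0 mulr1.
by rewrite risingSr exprS {1}/falling big_ord_recr/= -/(falling _ _) IH; ring.
Qed.

Lemma falling_nat (n l : nat) : falling (n%:R : K) l = (n ^_ l)%:R.
Proof.
elim: l => [|l IH]; first by rewrite /falling big_ord0 ffactn0.
rewrite /falling big_ord_recr/= -/(falling _ _) IH ffactnSr natrM.
have [ln|nl] := leqP l n; first by rewrite natrB.
by rewrite ffact_small// !mul0r.
Qed.

Lemma fact_neq0 n : n`!%:R != 0 :> K.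
Proof. by rewrite pnatr_eq0 -lt0n fact_gt0. Qed.

(** Duplication formula: two consecutive factors [2a + 2j] and [2a + 2j + 1] are twice the next
    factors of the two half-size products. This is why the parameters [a] and [a + 1/2] lead to
    [2a]. *)
Lemma rising_double a j :
  rising (2%:R * a) (2 * j) = 4%:R ^+ j * rising a j * rising (a + 1 / 2%:R) j.
Proof.
elim: j => [|j IH]; first by rewrite muln0 !rising0 expr0 !mulr1.
by rewrite mulnS addnC addn2 !risingSr IH exprS -[(2 * j).+1]addn1 natrD natrM; field.
Qed.

Lemma fact_double j : (2 * j)`!%:R = 4%:R ^+ j * rising (1 / 2%:R) j * j`!%:R :> K.
Proof.
rewrite -!rising1 -[X in rising X (2 * j)](_ : 2%:R * (1 / 2%:R) = 1); last by field.
by rewrite rising_double; congr (_ * rising _ _); field.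
Qed.

Lemma odd_dfact_rising m : (odd_dfact m)%:R = 2%:R ^+ m * rising (1 / 2%:R) m :> K.
Proof.
elim: m => [|m IH]; first by rewrite /odd_dfact big_ord0 rising0 mulr1.
rewrite /odd_dfact big_ord_recr/= -/(odd_dfact _) natrM IH risingSr exprS natrD natrM.
by field.
Qed.

Lemma odd_dfact_neq0 m : (odd_dfact m)%:R != 0 :> K.
Proof.
rewrite pnatr_eq0 -lt0n /odd_dfact; rewrite prodn_gt0// => i.
by rewrite addn1.
Qed.

Lemma rising_half_neq0 m : rising (1 / 2%:R) m != 0 :> K.
Proof.
by have := odd_dfact_neq0 m; rewrite odd_dfact_rising mulf_eq0 negb_or => /andP[].
Qed.

Lemma bin_double n : 'C(2 * n, n)%:R = 4%:R ^+ n * rising (1 / 2%:R) n / n`!%:R :> K.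
Proof.
apply: (mulIf (fact_neq0 n)); rewrite divfK ?fact_neq0//.
apply: (mulIf (fact_neq0 n)); rewrite -fact_double -!natrM -mulnA.
have := bin_fact (leq_addr n n); rewrite addnn -mul2n => <-.
by rewrite mul2n -addnn addnK.
Qed.

Lemma rising_Vandermonde x y m :
  \sum_(0 <= k < m.+1) 'C(m, k)%:R * rising x (m - k) * rising y k = rising (x + y) m.
Proof.
elim: m => [|m IH]; first by rewrite big_nat1 bin0 !rising0 !mulr1.
rewrite risingSr -IH mulr_suml.
pose F k := 'C(m, k)%:R * rising x (m - k) * rising y k : K.
(* The new factor [x + y + m] splits as [(x + (m - k)) + (y + k)], and each half lengthens one of
   the two rising factorials. Pascal's rule on the left matches this splitting. *)
rewrite [RHS](eq_big_nat _ _ (F2 := fun k => F k * (x + (m - k)%:R) + F k * (y + k%:R))); last first.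
  by move=> k /andP[_ km]; rewrite natrB// /F; ring.
rewrite [RHS]big_split/=.
rewrite big_nat_recl//= bin0 subn0 rising0.
under eq_big_nat => k /andP[_ km] do rewrite binS natrD !mulrDl subSS.
rewrite big_split/= addrA; congr (_ + _).
  rewrite [in RHS]big_nat_recl//= /F bin0 subn0 rising0 !mulr1 !mul1r -risingSr; congr (_ + _).
  rewrite big_nat_recr//= bin_small// !mul0r addr0.
  apply: eq_big_nat => k /andP[_ km].
  by rewrite (_ : (m - k)%N = (m - k.+1).+1) ?risingSr; [ring|lia].
by apply: eq_bigr => k _; rewrite /F risingSr; ring.
Qed.

(* The recurrence produced by multiplying [sum_l (-1)^l q_l <y>_l] by [2k - y],
   since [y <y>_l = <y>_(l+1) + l <y>_l]. *)
Fixpoint qcoef (k l : nat) : K :=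
  if k is k'.+1 then
    (2%:R * k'%:R - l%:R) * qcoef k' l + (if l is l'.+1 then qcoef k' l' else 0)
  else (l == 0)%:R.

Lemma qcoef_gt k l : (k < l)%N -> qcoef k l = 0.
Proof.
elim: k l => [|k IH] [|l]//= kl.
by rewrite !IH ?mulr0 ?addr0// ltnW.
Qed.

Lemma qcoef_S0 k : qcoef k.+1 0 = 0.
Proof. by elim: k => [|k IH] /=; [ring|rewrite /= in IH; rewrite IH; ring]. Qed.

(** With [l = j + 1] and [d = k - l], the upper index [2k - l - 1] is [2d + j], free of subtraction.
    The two terms of the recurrence lower [d] or [j] by one, hence an induction on [d + j]. *)
Lemma qcoef_SS d j : qcoef (d + j).+1 j.+1 = (odd_dfact d * 'C(2 * d + j, j))%:R.
Proof.
move: {2}(d + j)%N (erefl (d + j)%N) => k; elim: k d j => [|k IH] d j.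
  move=> /eqP; rewrite addn_eq0 => /andP[/eqP-> /eqP->] /=.
  by rewrite /odd_dfact big_ord0 muln0 add0n bin0 muln1; ring.
move=> dj; rewrite dj -[LHS]/((2%:R * k.+1%:R - j.+1%:R) * qcoef k.+1 j.+1 + qcoef k.+1 j).
have q1 : qcoef k.+1 j = if j is j'.+1 then (odd_dfact d * 'C(2 * d + j', j'))%:R else 0.
  case: j dj => [|j] dj; first exact: qcoef_S0.
  by rewrite -IH; [congr (qcoef _ _); lia|lia].
(* On the diagonal [d = 0] the first term of the recurrence lies beyond [l = k] and vanishes. *)
case: d dj q1 => [|d] dj q1.
  rewrite qcoef_gt ?q1; last by lia.
  case: j dj {q1} => // j _; rewrite !muln0 !add0n !binn; ring.
have -> : k = (d + j)%N by lia.
rewrite IH; last by lia.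
have -> : qcoef (d + j).+1 j = (if j is j'.+1 then (odd_dfact d.+1 * 'C(2 * d.+1 + j', j'))%:R else 0).
  by rewrite -q1; congr (qcoef _ _); lia.
have oS : odd_dfact d.+1 = (odd_dfact d * (2 * d + 1))%N by rewrite /odd_dfact big_ord_recr.
(* Absorption trades the factor [2k - l] of the recurrence for the last factor of the larger double
   factorial. What remains is Pascal's rule. *)
have key : ((2 * d + 1) * 'C(2 * d + j.+1, j) = (2 * d + j.+1) * 'C(2 * d + j, j))%N.
  by have := mul_bin_down (2 * d + j.+1) j; rewrite addnS /= => ->; congr (_ * _)%N; lia.
have -> : 2%:R * (d + j).+1%:R - j.+1%:R = (2 * d + j.+1)%:R :> K.
  by rewrite -natrM -natrB; [congr (_%:R); lia|lia].
rewrite -natrM mulnCA -key oS.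
case: j {dj q1 key} => [|j].
  by rewrite !bin0 addr0; congr (_%:R); lia.
rewrite -natrD; congr (_%:R).
have -> : (2 * d.+1 + j.+1 = (2 * d + j.+2).+1)%N by lia.
have -> : (2 * d.+1 + j = 2 * d + j.+2)%N by lia.
by rewrite binS; nia.
Qed.

Lemma qcoefE k l : (l <= k)%N ->
  (odd_dfact (k - l))%:R * ebinom ((2 * k%:Z - l%:Z - 1)%:~R) (l%:Z - 1) = qcoef k l.
Proof.
case: l => [|l] lk.
  rewrite subn0 /= /ebinom.
  case: k {lk} => [|k].
    by rewrite /odd_dfact big_ord0 mul1r /= eqxx.
  rewrite qcoef_S0.
  have -> : (2 * k.+1%:Z - 0%:Z - 1)%:~R = (2 * k + 1)%:R :> K.
    by rewrite -[RHS]/((2 * k + 1)%N%:Z%:~R); congr (_%:~R); lia.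
  (* For [l = 0] the lower index is [-1], and the coefficient is 1 only at upper index [-1], that is
     for [k = 0]. Here the upper index is positive. *)
  rewrite ifF ?mulr0//; apply/negbTE; rewrite negb_and; apply/orP; left.
  by rewrite gt_eqF// (lt_le_trans (@ltrN10 K)).
have [d ->] : exists d, k = (d + l).+1 by exists (k - l.+1)%N; lia.
rewrite qcoef_SS (_ : (d + l).+1 - l.+1 = d)%N; last by lia.
rewrite (_ : l.+1%:Z - 1 = l%:Z); last by lia.
rewrite natrM; congr (_ * _); rewrite /ebinom.
have -> : (2 * (d + l).+1%:Z - l.+1%:Z - 1)%:~R = (2 * d + l)%:R :> K.
  by rewrite -[RHS]/((2 * d + l)%N%:Z%:~R); congr (_%:~R); lia.
rewrite falling_nat -bin_ffact natrM mulfK// fact_neq0//.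
Qed.

Lemma sum_qcoef k y :
  \sum_(0 <= l < k.+1) qcoef k l * ((-1) ^+ l * falling y l) =
  2%:R ^+ k * rising (- y / 2%:R) k.
Proof.
elim: k => [|k IH].
  by rewrite big_nat1 /= /falling big_ord0 rising0 !expr0 !mulr1.
have -> : 2%:R ^+ k.+1 * rising (- y / 2%:R) k.+1 =
    (2%:R * k%:R - y) * (2%:R ^+ k * rising (- y / 2%:R) k).
  by rewrite risingSr exprS; field.
rewrite -IH.
under eq_big_nat => l _ do rewrite [qcoef _ _]/= mulrDl.
rewrite big_split/= big_nat_recr//= qcoef_gt// mulr0 mul0r addr0.
(* After reindexing, [qcoef k l] multiplies [(2k - l) - (y - l) = 2k - y], the same factor for every
   [l]. *)
rewrite [X in _ + X]big_nat_recl//= mul0r add0r -big_split/= mulr_sumr.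
apply: eq_bigr => l _; rewrite {2}/falling big_ord_recr/= -/(falling _ _) exprS.
by field.
Qed.

Lemma sum_bin_rising m y :
  \sum_(0 <= k < m.+1) 2%:R ^+ k / k`!%:R * 'C(2 * m - 2 * k, m - k)%:R *
     (2%:R ^+ k * rising (- y / 2%:R) k) =
  4%:R ^+ m / m`!%:R * rising ((1 - y) / 2%:R) m.
Proof.
have -> : (1 - y) / 2%:R = 1 / 2%:R + (- y / 2%:R) by field.
rewrite -rising_Vandermonde mulr_sumr; apply: eq_big_nat => k /andP[_ km].
have {}km : (k <= m)%N by [].
rewrite -mulnBr bin_double.
have -> : 'C(m, k)%:R = m`!%:R / (k`!%:R * (m - k)`!%:R) :> K.
  by apply: (canRL (mulfK _)); rewrite ?mulf_neq0 ?fact_neq0// -!natrM bin_fact.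
have -> : 4%:R ^+ m = 2%:R ^+ k * 2%:R ^+ k * 4%:R ^+ (m - k) :> K.
  by rewrite -exprMn -natrM -exprD subnKC.
by field; rewrite !fact_neq0.
Qed.

(** The reflection formula of the Gamma function at half-integers, in finite form. It trades the
    denominator [(1/2 - m)_j], whose length grows with [j], for [(1/2 - j)_m], a polynomial in [j]
    of degree [m]. *)
Lemma rising_half_swap m j :
  rising (1 / 2%:R) m * rising (1 / 2%:R) j =
  rising (1 / 2%:R - m%:R) j * rising (1 / 2%:R - j%:R) m :> K.
Proof.
elim: j => [|j IH]; first by rewrite !rising0 subr0 mulr1 [RHS]mul1r.
rewrite !risingSr mulrA IH.
have h := risingSl (1 / 2%:R - j.+1%:R : K) m.
rewrite risingSr in h.
have e : 1 / 2%:R - j.+1%:R + 1 = 1 / 2%:R - j%:R :> K by rewrite -natr1; ring.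
rewrite e in h.
have -> : rising (1 / 2%:R - m%:R) j * (1 / 2%:R - m%:R + j%:R) * rising (1 / 2%:R - j.+1%:R) m
  = - rising (1 / 2%:R - m%:R) j * (rising (1 / 2%:R - j.+1%:R) m * (1 / 2%:R - j.+1%:R + m%:R)) :> K.
  by rewrite -natr1; field.
by rewrite h -natr1; field.
Qed.

Lemma rising_half_sub_neq0 m j : rising (1 / 2%:R - m%:R) j != 0 :> K.
Proof.
have := mulf_neq0 (rising_half_neq0 m) (rising_half_neq0 j).
by rewrite rising_half_swap mulf_eq0 negb_or => /andP[].
Qed.

(** The target of the matching: up to a constant, the coefficient of [z^(2j)] in [(1 - z)^(-2a)]
    times a polynomial in [y = 2j]. The latter is the value of the Vandermonde convolution in
    [sum_bin_rising]. *)
Lemma hyp2F1_coef_half a m j :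
  hyp2F1_coef a (a + 1 / 2%:R) (1 / 2%:R - m%:R) j =
  2%:R ^+ m / (odd_dfact m)%:R *
  (rising (2%:R * a) (2 * j) / (2 * j)`!%:R * rising ((1 - (2 * j)%:R) / 2%:R) m).
Proof.
rewrite /hyp2F1_coef rising_double fact_double odd_dfact_rising.
have -> : (1 - (2 * j)%:R) / 2%:R = 1 / 2%:R - j%:R :> K by rewrite natrM; field.
have -> : rising (1 / 2%:R - j%:R) m =
    rising (1 / 2%:R) m * rising (1 / 2%:R) j / rising (1 / 2%:R - m%:R) j :> K.
  by apply: (mulIf (rising_half_sub_neq0 m j)); rewrite divfK ?rising_half_sub_neq0// rising_half_swap mulrC.
field.
rewrite !fact_neq0 !rising_half_neq0 rising_half_sub_neq0 !expf_neq0 ?pnatr_eq0//.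
Qed.

End Combinatorics.

(** * The real-valued modulus [normc] and convergence of complex sequences *)

Section Modulus.
Variable R : realType.
Local Notation C := (R[i] : numFieldType).
Implicit Types z w : C.

Lemma normcE_Re z : complex.Re `|z| = normc z.
Proof. by []. Qed.

Lemma normr_normc z : `|z| = (normc z)%:C.
Proof. by []. Qed.

Lemma normc_ge0 z : 0 <= normc z.
Proof. by case: z => x y; exact: sqrtr_ge0. Qed.

Lemma normc_eq0 z : (normc z == 0) = (z == 0).
Proof.
by apply/eqP/eqP => [/eq0_normc//|->]; exact: normc0.
Qed.

Lemma normc_gt0 z : (0 < normc z) = (z != 0).
Proof. by rewrite lt_neqAle normc_ge0 andbT eq_sym normc_eq0. Qed.

Lemma normcD_le z w : normc (z + w) <= normc z + normc w.
Proof. exact: le_normcD. Qed.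

Lemma normc_opp z : normc (- z) = normc z.
Proof. exact: normcN. Qed.

Lemma normcB_sym z w : normc (z - w) = normc (w - z).
Proof. by rewrite -(normc_opp (w - z)) opprB. Qed.

Lemma normcX z n : normc (z ^+ n) = normc z ^+ n.
Proof.
elim: n => [|n IH]; first by rewrite !expr0 normc1.
by rewrite !exprS normcM IH.
Qed.

Lemma normc_real (x : R) : 0 <= x -> normc x%:C = x.
Proof. by move=> x0; rewrite /= expr0n addr0 sqrtr_sqr ger0_norm. Qed.

Lemma normc_nat n : normc (n%:R : R[i]) = n%:R.
Proof. by rewrite -(rmorph_nat (real_complex R)) normc_real. Qed.

Lemma normc_sum m n (u : nat -> R[i]) :
  normc (\sum_(m <= k < n) u k) <= \sum_(m <= k < n) normc (u k).
Proof.
elim/big_rec2: _ => [|i y x _ h]; first by rewrite normc0.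
by rewrite (le_trans (normcD_le _ _))// lerD2l.
Qed.

Lemma normcB_le_abs z w : `|normc z - normc w| <= normc (z - w).
Proof.
have h1 : normc w <= normc (z - w) + normc z.
  by rewrite normcB_sym -{1}(subrK z w); exact: normcD_le.
have h2 : normc z <= normc (z - w) + normc w.
  by rewrite -{1}(subrK w z); exact: normcD_le.
by rewrite ler_norml; apply/andP; split; lra.
Qed.

Lemma Re_le_normc z : `|complex.Re z| <= normc z.
Proof.
case: z => x y /=; rewrite -sqrtr_sqr ler_sqrt ?addr_ge0 ?sqr_ge0//.
by rewrite lerDl sqr_ge0.
Qed.

Lemma Im_le_normc z : `|complex.Im z| <= normc z.
Proof.
case: z => x y /=; rewrite -sqrtr_sqr ler_sqrt ?addr_ge0 ?sqr_ge0//.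
by rewrite lerDr sqr_ge0.
Qed.

Lemma normc_le_ReIm z : normc z <= `|complex.Re z| + `|complex.Im z|.
Proof.
case: z => x y /=; rewrite -(ler_pXn2r (n:=2))// ?nnegrE ?sqrtr_ge0 ?addr_ge0//.
rewrite sqr_sqrtr ?addr_ge0 ?sqr_ge0// sqrrD !real_normK ?num_real//.
by rewrite lerD2r lerDl mulrn_wge0// mulr_ge0.
Qed.

Lemma cReD z w : complex.Re (z + w) = complex.Re z + complex.Re w.
Proof. by case: z; case: w. Qed.

Lemma cImD z w : complex.Im (z + w) = complex.Im z + complex.Im w.
Proof. by case: z; case: w. Qed.

Lemma cReB z w : complex.Re (z - w) = complex.Re z - complex.Re w.
Proof. by case: z; case: w. Qed.

Lemma cImB z w : complex.Im (z - w) = complex.Im z - complex.Im w.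
Proof. by case: z; case: w. Qed.

Lemma cReM z w : complex.Re (z * w) =
  complex.Re z * complex.Re w - complex.Im z * complex.Im w.
Proof. by case: z; case: w. Qed.

Lemma cImM z w : complex.Im (z * w) =
  complex.Re z * complex.Im w + complex.Im z * complex.Re w.
Proof. by case: z => ? ?; case: w => ? ? /=. Qed.

Lemma normr_lt z (x : R) : (`|z| < x%:C) = (normc z < x).
Proof. by rewrite normr_normc ltcR. Qed.

Lemma cvgcP (u : nat -> C) (l : C) :
  u @ \oo --> l <-> (fun n => normc (u n - l)) @ \oo --> (0 : R).
Proof.
split.
  move/cvgrPdist_lt => H; apply/cvgrPdist_lt => e e0.
  have e0' : 0 < e%:C by rewrite ltcR.
  have := H _ e0'; apply: filterS => n; rewrite normr_lt => h.
  by rewrite sub0r normrN ger0_norm ?normc_ge0// normcB_sym.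
(* The radius is a priori an element of [R[i]]; being positive forces its imaginary part to be 0. *)
move/cvgrPdist_lt => H; apply/cvgrPdist_lt => -[e e'] /=.
rewrite ltcE/= => /andP[/eqP-> e0].
have := H _ e0; apply: filterS => n.
by rewrite sub0r normrN ger0_norm ?normc_ge0// normcB_sym normr_lt.
Qed.

Lemma cvgc_ReIm (u : nat -> C) (l : C) :
  (fun n => complex.Re (u n)) @ \oo --> complex.Re l ->
  (fun n => complex.Im (u n)) @ \oo --> complex.Im l -> u @ \oo --> l.
Proof.
move=> /cvgrPdist_lt H1 /cvgrPdist_lt H2; apply/cvgcP/cvgrPdist_lt => e e0.
have e2 : 0 < e / 2 by rewrite divr_gt0.
near=> n; rewrite sub0r normrN ger0_norm ?normc_ge0//.
rewrite (le_lt_trans (normc_le_ReIm _))// [ltRHS]splitr ltrD//.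
  have : `|complex.Re l - complex.Re (u n)| < e / 2 by near: n; exact: H1.
  by rewrite distrC (cReB, cImB).
have : `|complex.Im l - complex.Im (u n)| < e / 2 by near: n; exact: H2.
by rewrite distrC (cReB, cImB).
Unshelve. all: by end_near. Qed.

Lemma cvgc_normc (u : nat -> C) (l : C) : u @ \oo --> l ->
  (fun n => normc (u n)) @ \oo --> normc l.
Proof.
move=> /cvgcP/cvgrPdist_lt H; apply/cvgrPdist_lt => e e0.
have := H _ e0; apply: filterS => n.
rewrite sub0r normrN ger0_norm ?normc_ge0// normcB_sym; apply: le_lt_trans.
exact: normcB_le_abs.
Qed.

Lemma cvgc_unique (u : nat -> C) (l l' : C) :
  u @ \oo --> l -> u @ \oo --> l' -> l = l'.
Proof. by move=> H H'; apply: (cvg_unique _ H H'). Qed.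

Lemma cvgc_normc_le (u : nat -> C) (l : C) (M : R) : u @ \oo --> l ->
  (\forall n \near \oo, normc (u n) <= M) -> normc l <= M.
Proof.
move=> /cvgc_normc H HM; rewrite -(cvg_lim _ H)//.
by apply: limr_le => //; apply/cvg_ex; eexists; exact: H.
Qed.

End Modulus.

(** * Sums of complex series, absolute bounds, and exchange of limit and sum *)

Section Series.
Variable R : realType.
Local Notation C := (R[i] : numFieldType).
Implicit Types (z w l : C) (u v : nat -> C).

Lemma cvgcD u v l l' : u @ \oo --> l -> v @ \oo --> l' ->
  (fun n => u n + v n) @ \oo --> l + l'.
Proof. by move=> hu hv; exact: (cvgD hu hv). Qed.

Lemma cvgc_subr z u l : u @ \oo --> l -> (fun n => u n - z) @ \oo --> l - z.
Proof. by move=> hu; exact: (cvgB hu (cvg_cst z)). Qed.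

Lemma cvgc_sum N (v : nat -> nat -> C) (h : nat -> C) :
  (forall i, (i < N)%N -> v i @ \oo --> h i) ->
  (fun k => \sum_(0 <= i < N) v i k) @ \oo --> \sum_(0 <= i < N) h i.
Proof.
elim: N => [|N IH] vh.
  have -> : (fun k => \sum_(0 <= i < 0) v i k) = cst 0.
    by apply/funext => k; rewrite big_nil.
  by rewrite big_nil; exact: cvg_cst.
have -> : (fun k => \sum_(0 <= i < N.+1) v i k) =
    (fun k => \sum_(0 <= i < N) v i k + v N k).
  by apply/funext => k; rewrite big_nat_recr.
rewrite big_nat_recr//=.
exact: (cvgcD (IH (fun i iN => vh i (ltnW iN))) (vh N (leqnn _))).
Qed.

(* An inductive wrapper, so that unification never unfolds the limit. *)
Variant hsum u l : Prop := HSum of series u @ \oo --> l.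

Lemma hsumP u l : hsum u l <-> series u @ \oo --> l.
Proof. by split=> [[]|]. Qed.

Definition abs_le u (M : R) : Prop :=
  forall n, \sum_(0 <= k < n) normc (u k) <= M.

Lemma hsum_unique u l l' : hsum u l -> hsum u l' -> l = l'.
Proof. by move=> [h] [h']; exact: cvgc_unique h h'. Qed.

Lemma eq_hsum u v l l' : (forall n, u n = v n) -> l = l' -> hsum u l -> hsum v l'.
Proof. by move=> /funext -> ->. Qed.

Lemma hsumD u v l l' : hsum u l -> hsum v l' -> hsum (fun n => u n + v n) (l + l').
Proof.
move=> [hu] [hv]; split.
have -> : series (fun n => u n + v n) = (fun n => series u n + series v n).
  by apply/funext => n; rewrite /series/= big_split.
exact: (cvgcD hu hv).
Qed.

Lemma hsumMl (a : C) u l : hsum u l -> hsum (fun n => a * u n) (a * l).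
Proof.
move=> [hu]; split; have -> : series (fun n => a * u n) = (fun n => a * series u n).
  by apply/funext => n; rewrite /series/= mulr_sumr.
exact: (cvgM (cvg_cst a) hu).
Qed.
Arguments hsumMl a {u l} _.

Lemma hsumB u v l l' : hsum u l -> hsum v l' -> hsum (fun n => u n - v n) (l - l').
Proof.
move=> hu /(hsumMl (-1)) hv.
by apply: eq_hsum (hsumD hu hv) => [n|]; rewrite mulN1r.
Qed.

Lemma hsum0 : hsum (fun=> 0) 0.
Proof.
split; have -> : series (fun=> 0 : C) = (fun=> 0).
  by apply/funext => n; rewrite /series/= big1.
exact: cvg_cst.
Qed.

Lemma hsum_sum (m : nat) (u : nat -> nat -> C) (l : nat -> C) :
  (forall j, (j < m)%N -> hsum (u j) (l j)) ->
  hsum (fun n => \sum_(0 <= j < m) u j n) (\sum_(0 <= j < m) l j).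
Proof.
elim: m => [|m IH] h.
  by apply: eq_hsum hsum0 => [n|]; rewrite big_nil.
apply: eq_hsum (hsumD (IH _) (h m _)) => // [n||j jm]; rewrite ?big_nat_recr//=.
by apply: h; exact: ltnW.
Qed.

Lemma hsum_fin m u : (forall n, (m <= n)%N -> u n = 0) ->
  hsum u (\sum_(0 <= j < m) u j).
Proof.
move=> u0; split; apply: cvg_near_cst; exists m => // n /= mn.
rewrite /series/= (big_cat_nat (n := m))//= -[RHS]addr0; congr (_ + _).
by rewrite big_nat_cond big1// => i /andP[/andP[/u0]].
Qed.

Lemma hsum_shift m u l : hsum u l ->
  hsum (fun n => if (n < m)%N then 0 else u (n - m)%N) l.
Proof.
move=> [hu]; split; rewrite -(@cvg_shiftn m); apply: cvg_trans hu.
apply: near_eq_cvg; near=> n; rewrite /series/= [RHS](big_cat_nat (n := m))//= ?leq_addl//.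
rewrite [X in _ = X + _]big_nat_cond [X in _ = X + _]big1 ?add0r; last first.
  by move=> i /andP[/andP[_ ->]].
rewrite -[X in _ = \sum_(X <= _ < _) _]add0n big_addn addnK; apply: eq_bigr => i _.
by rewrite addnK ltnNge leq_addl.
Unshelve. all: by end_near. Qed.

Lemma hsum_behead u l : hsum u l -> hsum (fun n => u n.+1) (l - u 0%N).
Proof.
move=> [/(cvg_comp _ _ (cvg_addnr 1)) h]; split.
have -> : series (fun n => u n.+1) = (fun n => series u (n + 1)%N - u 0%N).
  apply/funext => n; rewrite /series/= addn1 big_nat_recl//= [RHS]addrC addKr //.
exact: (@cvgc_subr (u 0%N) (fun n => series u (n + 1)%N) l h).
Qed.

Lemma hsum_even u l : (forall n, odd n -> u n = 0) -> hsum u l ->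
  hsum (fun n => u n.*2) l.
Proof.
move=> u0 [hu]; split.
have -> : series (fun n => u n.*2) = (fun n => series u n.*2).
  apply/funext; rewrite /series/=; elim => [|n IH].
    by rewrite !big_nil.
  by rewrite doubleS !big_nat_recr//= IH (u0 n.*2.+1) ?addr0// oddS odd_double.
apply: cvg_comp hu => A [N _ NA]; exists N => // n /= Nn; apply: NA => /=.
by rewrite (leq_trans Nn)// -addnn leq_addr.
Qed.

Lemma bounded_cvg (m : nat -> R) (M : R) : (forall n, 0 <= m n) ->
  (forall n, \sum_(0 <= k < n) m k <= M) -> cvgn (series m).
Proof.
move=> m0 mM; apply: nondecreasing_is_cvgn.
  exact: nondecreasing_series.
by exists M => _ [n _ <-]; exact: mM.
Qed.

Lemma series_Re u : series (fun n => complex.Re (u n)) =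
  (fun n => complex.Re (series u n)).
Proof. by apply/funext => n; rewrite /series/= (big_morph _ (@cReD R) erefl). Qed.

Lemma series_Im u : series (fun n => complex.Im (u n)) =
  (fun n => complex.Im (series u n)).
Proof. by apply/funext => n; rewrite /series/= (big_morph _ (@cImD R) erefl). Qed.

Lemma hsum_ReIm u l :
  series (fun n => complex.Re (u n)) @ \oo --> complex.Re l ->
  series (fun n => complex.Im (u n)) @ \oo --> complex.Im l -> hsum u l.
Proof. by rewrite series_Re series_Im => h h'; split; exact: cvgc_ReIm. Qed.

Lemma abs_le_hsum u M : abs_le u M -> exists l, hsum u l.
Proof.
move=> uM.
have cv (f : C -> R) : (forall z, `|f z| <= normc z) ->
    cvgn (series (fun n => f (u n))).
  move=> fz; apply: normed_cvg; apply: (@bounded_cvg _ M) => n /=; first exact: normr_ge0.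
  by apply: le_trans (uM n); apply: ler_sum => k _.
have /cvg_ex[a ha] := cv _ (@Re_le_normc R).
have /cvg_ex[b hb] := cv _ (@Im_le_normc R).
by exists (a +i* b); apply: hsum_ReIm.
Qed.

Lemma hsum_normc_le u l M : abs_le u M -> hsum u l -> normc l <= M.
Proof.
move=> uM [hu]; apply: cvgc_normc_le hu _; near=> n.
exact: le_trans (normc_sum _ _ _) (uM n).
Unshelve. all: by end_near. Qed.

(** Dominated convergence for series: beyond some rank the tails are small uniformly in [k], thanks
    to [m], and the finitely many remaining terms converge together. It supplies the interchange of
    summations in [psum_series]. *)
Lemma tannery (v : nat -> nat -> C) (m : nat -> R) (h S : nat -> C) L :
  cvgn (series m) ->
  (forall n k, normc (v n k) <= m n) ->
  (forall n, v n @ \oo --> h n) ->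
  (forall k, hsum (v^~ k) (S k)) -> hsum h L -> S @ \oo --> L.
Proof.
move=> cm vm vh vS hL.
have m0 n : 0 <= m n by apply: le_trans (vm n 0%N); exact: normc_ge0.
have hm n : normc (h n) <= m n by apply: cvgc_normc_le (vh n) _; near=> k.
(* Used twice, for the limit row and for each row [k]; with the finite comparison this gives three
   errors of at most [e / 4]. *)
have tail N u l : (forall n, normc (u n) <= m n) -> hsum u l ->
    normc (l - \sum_(0 <= i < N) u i) <= limn (series m) - \sum_(0 <= i < N) m i.
  move=> um [hu].
  have h0 : (fun n => series u n - \sum_(0 <= i < N) u i) @ \oo --> l - \sum_(0 <= i < N) u i.
    exact: (@cvgc_subr _ (series u) l hu).
  apply: cvgc_normc_le h0 _; near=> n.
  have Nn : (N <= n)%N by near: n; exists N.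
  rewrite /series/= (big_cat_nat (n := N))//= [X in normc X]addrC addKr.
  have := nondecreasing_cvgn_le (nondecreasing_series (fun n _ _ => m0 n)) cm n.
  rewrite /series/= (big_cat_nat (n := N))//= -lerBrDl; apply: le_trans.
  apply: le_trans (normc_sum _ _ _) _; apply: ler_sum => i _; exact: um.
apply/cvgcP/cvgrPdist_lt => e e0.
have e4 : 0 < e / 4 by rewrite divr_gt0.
have [N hN] : exists N, limn (series m) - \sum_(0 <= i < N) m i < e / 4.
  have /cvgrPdist_lt/(_ _ e4)[N _ hN] : series m @ \oo --> limn (series m) by [].
  by exists N; have := hN N (leqnn N); apply: le_lt_trans; exact: ler_norm.
have fin : (fun k => \sum_(0 <= i < N) v i k) @ \oo --> \sum_(0 <= i < N) h i.
  exact: (cvgc_sum (fun i _ => vh i)).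
have /cvgcP/cvgrPdist_lt/(_ _ e4) finN := fin.
near=> k; rewrite sub0r normrN ger0_norm ?normc_ge0//.
have a1 := tail N _ _ hm hL.
have a2 := tail N _ _ (fun n => vm n k) (vS k).
have a3 : normc (\sum_(0 <= i < N) v i k - \sum_(0 <= i < N) h i) < e / 4.
  have : `|0 - normc (\sum_(0 <= i < N) v i k - \sum_(0 <= i < N) h i)| < e / 4.
    by near: k; exact: finN.
  by rewrite sub0r normrN ger0_norm ?normc_ge0.
rewrite normcB_sym in a1.
set x := \sum_(0 <= i < N) v i k in a2 a3; set y := \sum_(0 <= i < N) h i in a1 a3.
have -> : S k - L = (S k - x) + ((x - y) + (y - L)) by ring.
have b1 := normcD_le (S k - x) ((x - y) + (y - L)).
have b2 := normcD_le (x - y) (y - L).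
lra.
Unshelve. all: by end_near. Qed.

End Series.

(** * Power series with a bound on the l1 norm, and the analytic functions they define *)

Section PowerSeries.
Variable R : realType.
Local Notation C := (R[i] : numFieldType).
Implicit Types (r M : R) (f g : C -> C).

(** The bound [M] also dominates [f] on the closed disc ([psum_normc_le]), so it can be compared
    with the radius of an outer series in a composition. *)
Definition psum f r M := exists2 u : nat -> C,
  (forall n, \sum_(0 <= k < n) normc (u k) * r ^+ k <= M) &
  forall t : C, normc t <= r -> hsum (fun k => u k * t ^+ k) (f t).

Lemma psum_ge0 f r M : psum f r M -> 0 <= M.
Proof. by case=> u /(_ 0%N); rewrite big_nil. Qed.

Lemma psum_abs_le (u : nat -> C) r M (t : C) : normc t <= r ->
  (forall n, \sum_(0 <= k < n) normc (u k) * r ^+ k <= M) ->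
  abs_le (fun k => u k * t ^+ k) M.
Proof.
move=> tr uM n; apply: le_trans (uM n); apply: ler_sum => k _.
by rewrite normcM normcX ler_wpM2l ?normc_ge0// lerXn2r ?nnegrE ?normc_ge0// (le_trans (normc_ge0 t)).
Qed.

Lemma psum_normc_le f r M (t : C) : psum f r M -> normc t <= r -> normc (f t) <= M.
Proof.
by case=> u uM uf tr; apply: hsum_normc_le (psum_abs_le tr uM) (uf _ tr).
Qed.

Lemma eq_psum f g r M : (forall t, normc t <= r -> f t = g t) -> psum f r M -> psum g r M.
Proof. by move=> fg [u uM uf]; exists u => // t tr; rewrite -(fg t tr); exact: uf. Qed.

Lemma psum_radius_le f r r' M : 0 <= r' -> r' <= r -> psum f r M -> psum f r' M.
Proof.
move=> r'0 r'r [u uM uf]; exists u; last by move=> t tr; apply: uf; exact: le_trans tr r'r.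
move=> n; apply: le_trans (uM n); apply: ler_sum => k _.
by rewrite ler_wpM2l ?normc_ge0// lerXn2r ?nnegrE// (le_trans r'0).
Qed.

Lemma psum_cst (c : C) r : psum (fun=> c) r (normc c).
Proof.
exists (fun k => if k is 0%N then c else 0) => [n|t _].
  case: n => [|n]; first by rewrite big_nil normc_ge0.
  rewrite big_nat_recl//= expr0 mulr1 big1 ?addr0// => i _.
  by rewrite expr0n addr0 sqrtr0 mul0r.
have := @hsum_fin R 1 (fun k => (if k is 0%N then c else 0) * t ^+ k).
rewrite big_nat1 expr0 mulr1; apply=> -[//|k _]; exact: mul0r.
Qed.

Lemma psumD f g r M M' : psum f r M -> psum g r M' ->
  psum (fun t => f t + g t) r (M + M').
Proof.
case=> u uM uf [v vM vg].
(* A negative radius gives an empty disc, where zero coefficients do. *)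
have [r0|r0] := leP 0 r; last first.
  exists (fun=> 0) => [n|t]; last first.
    by move=> tr; have := le_trans (normc_ge0 t) tr; rewrite leNgt r0.
  rewrite big1 => [|i _]; last by rewrite normc0 mul0r.
  by have := uM 0%N; have := vM 0%N; rewrite !big_nil => *; exact: addr_ge0.
exists (fun k => u k + v k) => [n|t tr].
  apply: le_trans (lerD (uM n) (vM n)); rewrite -big_split/=; apply: ler_sum => k _.
  by rewrite -mulrDl ler_wpM2r ?exprn_ge0// normcD_le.
by apply: eq_hsum (hsumD (uf _ tr) (vg _ tr)) => // n; rewrite mulrDl.
Qed.

Lemma psumZ (c : C) f r M : psum f r M -> psum (fun t => c * f t) r (normc c * M).
Proof.
case=> u uM uf; exists (fun k => c * u k) => [n|t tr].
  under eq_bigr do rewrite normcM -mulrA.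
  by rewrite -mulr_sumr ler_wpM2l ?normc_ge0.
by apply: eq_hsum (hsumMl c (uf _ tr)) => // n; rewrite mulrA.
Qed.

Lemma psum_mulX f r M : 0 <= r -> psum f r M -> psum (fun t => t * f t) r (r * M).
Proof.
move=> r0 [u uM uf].
exists (fun k => if k is k'.+1 then u k' else 0) => [[|n]|t tr].
- by rewrite big_nil mulr_ge0//; have := uM 0%N; rewrite big_nil.
- rewrite big_nat_recl//= expr0n addr0 sqrtr0 mul0r add0r.
  under eq_bigr do rewrite exprS mulrCA.
  by rewrite -mulr_sumr ler_wpM2l.
- apply: eq_hsum (hsum_shift 1 (hsumMl t (uf _ tr))) => // -[|n] /=.
    by rewrite mul0r.
  by rewrite subn1/= exprS mulrCA.
Qed.

Lemma psum_mulXn f r M n : 0 <= r -> psum f r M ->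
  psum (fun t => t ^+ n * f t) r (r ^+ n * M).
Proof.
move=> r0 h; elim: n => [|n IH].
  by rewrite expr0 mul1r; apply: eq_psum h => t _; rewrite expr0 mul1r.
rewrite exprS -mulrA; apply: eq_psum (psum_mulX r0 IH) => t _.
by rewrite exprS mulrA.
Qed.

(** The one rearrangement of a double series: expand each [h n], then collect the powers of [t].
    Products ([h n = u n * t^n * g]) and compositions ([h n = u n * g^n]) are both instances of
    it. *)
Lemma psum_series (h : nat -> C -> C) (m : nat -> R) f r M : 0 < r ->
  (forall n, psum (h n) r (m n)) ->
  (forall n, \sum_(0 <= k < n) m k <= M) ->
  (forall t, normc t <= r -> hsum (fun n => h n t) (f t)) -> psum f r M.
Proof.
move=> r0 hm mM hf.
have /choice[u hu] : forall n, exists u : nat -> C,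
   (forall K, \sum_(0 <= k < K) normc (u k) * r ^+ k <= m n) /\
   forall t : C, normc t <= r -> hsum (fun k => u k * t ^+ k) (h n t).
  by move=> n; have [u u1 u2] := hm n; exists u; split.
have m0 n : 0 <= m n by have := (hu n).1 0%N; rewrite big_nil.
have cm : cvgn (series m) by apply: bounded_cvg mM.
(* A single coefficient is at most its row bound divided by [r ^+ k], so each column is absolutely
   summable; its sum is the new coefficient. *)
have colM k : abs_le (fun n => u n k) (M / r ^+ k).
  move=> n; rewrite ler_pdivlMr ?exprn_gt0// mulr_suml.
  apply: le_trans (mM n); apply: ler_sum => i _.
  apply: le_trans ((hu i).1 k.+1); rewrite big_nat_recr//= lerDr sumr_ge0// => j _.
  by rewrite mulr_ge0 ?normc_ge0// exprn_ge0// ltW.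
have /choice[c hc] : forall k, exists ck, hsum (fun n => u n k) ck.
  by move=> k; exact: abs_le_hsum (colM k).
exists c => [K|t tr].
  (* The bound [M] is proved for the first [N] rows, where finite sums may be exchanged, and passes
     to the limit in [N]. *)
  have hK : (fun N => \sum_(0 <= k < K) normc (series (u^~ k) N) * r ^+ k) @ \oo -->
      \sum_(0 <= k < K) normc (c k) * r ^+ k.
    elim: K => [|K IH].
      have -> : (fun N => \sum_(0 <= k < 0) normc (series (u^~ k) N) * r ^+ k) = cst 0.
        by apply/funext => n; rewrite big_nil.
      by rewrite big_nil; exact: cvg_cst.
    rewrite big_nat_recr//=; under eq_fun do rewrite big_nat_recr//=.
    exact: (cvgD IH (cvgM (cvgc_normc ((hsumP _ _).1 (hc K))) (cvg_cst _))).
  rewrite -(cvg_lim _ hK)//; apply: limr_le; first by apply/cvg_ex; eexists; exact: hK.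
  near=> N; apply: le_trans (mM N).
  apply: (@le_trans _ _ (\sum_(0 <= k < K) \sum_(0 <= n < N) normc (u n k) * r ^+ k)).
    apply: ler_sum => k _; rewrite -mulr_suml ler_wpM2r ?exprn_ge0 ?(ltW r0)//.
    exact: normc_sum.
  by rewrite exchange_big/=; apply: ler_sum => n _; exact: (hu n).1.
have vb n K : normc (series (fun k => u n k * t ^+ k) K) <= m n.
  by apply: le_trans (normc_sum _ _ _) _; exact: (psum_abs_le tr (hu n).1).
(* The limit is taken in the truncation degree [K]: row [n] cut at degree [K] is dominated by
   [m n]. *)
split; apply: (tannery cm vb (fun n => (hsumP _ _).1 ((hu n).2 t tr)) _ (hf _ tr)) => K.
apply: hsum_sum => k _.
by apply: eq_hsum (hsumMl (t ^+ k) (hc k)) => [n|]; rewrite mulrC.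
Unshelve. all: by end_near. Qed.

Lemma psumM f g r M M' : 0 < r -> psum f r M -> psum g r M' ->
  psum (fun t => f t * g t) r (M * M').
Proof.
move=> r0 [u uM uf] hg; have M'0 := psum_ge0 hg.
apply: (psum_series (h := fun n t => u n * (t ^+ n * g t))
    (m := fun n => normc (u n) * (r ^+ n * M'))) => //.
- by move=> n; apply: psumZ; apply: psum_mulXn => //; exact: ltW.
- move=> n; under eq_bigr do rewrite mulrA.
  by rewrite -mulr_suml ler_wpM2r.
- move=> t tr; apply: eq_hsum (hsumMl (g t) (uf _ tr)) => [n|]; last exact: mulrC.
  by rewrite mulrC mulrA.
Qed.

Lemma psumX f r M n : 0 < r -> psum f r M -> psum (fun t => f t ^+ n) r (M ^+ n).
Proof.
move=> r0 h; elim: n => [|n IH].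
  by rewrite expr0 -(normc1 R); exact: psum_cst.
rewrite exprS; apply: eq_psum (psumM r0 h IH) => t _; by rewrite exprS.
Qed.

Lemma psum_comp f g r s M N : 0 < r -> psum f s N -> psum g r M -> M <= s ->
  psum (fun t => f (g t)) r N.
Proof.
move=> r0 [u uN uf] hg Ms; have M0 := psum_ge0 hg.
apply: (psum_series (h := fun n t => u n * g t ^+ n)
    (m := fun n => normc (u n) * M ^+ n)) => //.
- by move=> n; apply: psumZ; exact: psumX.
- move=> n; apply: le_trans (uN n); apply: ler_sum => k _.
  by rewrite ler_wpM2l ?normc_ge0// lerXn2r ?nnegrE// (le_trans M0).
- by move=> t tr; apply: uf; apply: le_trans (psum_normc_le hg tr) Ms.
Qed.

(** A Schwarz-type estimate: without a constant term, each [r' ^+ k] is at most [r' / r] times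
    [r ^+ k]. Shrinking the disc thus makes the norm of an inner function as small as a composition
    requires. *)
Lemma psum_vanish f r r' M : 0 < r -> 0 <= r' -> r' <= r -> f 0 = 0 ->
  psum f r M -> psum f r' (r' / r * M).
Proof.
move=> r0 r'0 r'r f0 [u uM uf].
have u0 : u 0%N = 0.
  have h0 : hsum (fun k => u k * 0 ^+ k) 0 by have := uf 0; rewrite f0; apply; rewrite normc0 ltW.
  have := hsum_fin (m := 1) (u := fun k => u k * 0 ^+ k).
  rewrite big_nat1 expr0 mulr1 => H; apply: hsum_unique (H _) h0.
  by case=> // n _; rewrite expr0n mulr0.
exists u; last by move=> t tr; apply: uf; exact: le_trans tr r'r.
move=> n; have q0 : 0 <= r' / r by rewrite divr_ge0// ltW.
have q1 : r' / r <= 1 by rewrite ler_pdivrMr// mul1r.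
apply: (@le_trans _ _ (r' / r * \sum_(0 <= k < n) normc (u k) * r ^+ k)); last first.
  by rewrite ler_wpM2l.
rewrite mulr_sumr; apply: ler_sum => -[_|k _].
  by rewrite u0 normc0 !mul0r mulr0.
rewrite mulrCA ler_wpM2l ?normc_ge0//.
have -> : r' ^+ k.+1 = (r' / r) ^+ k.+1 * r ^+ k.+1.
  by rewrite -exprMn divfK// gt_eqF.
by rewrite ler_wpM2r ?exprn_ge0 ?(ltW r0)// exprS ler_piMr// exprn_ile1.
Qed.

Definition analytic_psum f (x : C) :=
  exists r M, 0 < r /\ psum (fun t => f (x + t)) r M.

Lemma analytic_psumP f (x : C) : analytic_psum f x -> analytic_at f x.
Proof.
case=> r [M [r0 [u uM uf]]]; exists u.
have r0' : 0 < r%:C by rewrite ltcR.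
have := nbhsx_ballx x r%:C r0'; apply: filterS => y.
rewrite -ball_normE /ball_/= normr_normc ltcR => xy.
have yx : normc (y - x) <= r by rewrite normcB_sym ltW.
have -> : f y = f (x + (y - x)) by congr f; rewrite addrC subrK.
by have [] := uf _ yx.
Qed.

Lemma analytic_psum_cst (c x : C) : analytic_psum (fun=> c) x.
Proof. by exists 1, (normc c); split=> //; exact: psum_cst. Qed.

Lemma analytic_psum_id (x : C) : analytic_psum id x.
Proof.
exists 1, (normc x + 1 * normc (1 : C)); split=> //; apply: psumD; first exact: psum_cst.
by apply: eq_psum (psum_mulX ler01 (psum_cst 1 1)) => t _; rewrite mulr1.
Qed.

Lemma analytic_psum_bin f g h (x : C) :
  (forall r M M', 0 < r -> psum (fun t => f (x + t)) r M -> psum (fun t => g (x + t)) r M' ->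
    exists M'', psum (fun t => h (x + t)) r M'') ->
  analytic_psum f x -> analytic_psum g x -> analytic_psum h x.
Proof.
move=> H [r [M [r0 hf]]] [r' [M' [r'0 hg]]].
have m0 : 0 < Num.min r r' by rewrite lt_min r0.
have [||M'' hM''] := H (Num.min r r') M M' m0.
- by apply: psum_radius_le hf; [exact: ltW|rewrite ge_min lexx].
- by apply: psum_radius_le hg; [exact: ltW|rewrite ge_min lexx orbT].
by exists (Num.min r r'), M''.
Qed.

Lemma analytic_psumD f g (x : C) : analytic_psum f x -> analytic_psum g x ->
  analytic_psum (fun y => f y + g y) x.
Proof.
by apply: analytic_psum_bin => r M M' r0 h1 h2; exists (M + M'); exact: psumD.
Qed.

Lemma analytic_psumM f g (x : C) : analytic_psum f x -> analytic_psum g x ->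
  analytic_psum (fun y => f y * g y) x.
Proof.
by apply: analytic_psum_bin => r M M' r0 h1 h2; exists (M * M'); exact: psumM.
Qed.

Lemma analytic_psumX f (x : C) n : analytic_psum f x ->
  analytic_psum (fun y => f y ^+ n) x.
Proof.
by case=> r [M [r0 h]]; exists r, (M ^+ n); split => //; exact: psumX.
Qed.

Lemma analytic_psum_sum m (f : nat -> C -> C) (x : C) :
  (forall i, (i < m)%N -> analytic_psum (f i) x) ->
  analytic_psum (fun y => \sum_(0 <= i < m) f i y) x.
Proof.
elim: m => [|m IH] h.
  have -> : (fun y => \sum_(0 <= i < 0) f i y) = (fun=> 0).
    by apply/funext => y; rewrite big_nil.
  exact: analytic_psum_cst.
have -> : (fun y => \sum_(0 <= i < m.+1) f i y) =
    (fun y => \sum_(0 <= i < m) f i y + f m y).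
  by apply/funext => y; rewrite big_nat_recr.
apply: analytic_psumD; last exact: h.
by apply: IH => i im; apply: h; exact: ltnW.
Qed.

Lemma analytic_psum_comp f g (x : C) : analytic_psum f (g x) -> analytic_psum g x ->
  analytic_psum (fun y => f (g y)) x.
Proof.
move=> [s [N [s0 hf]]] [r [M [r0 hg]]].
have h0 := psumD hg (psum_cst (- g x) r).
set M1 := M + _ in h0; have M10 := psum_ge0 h0.
(* With this radius [r' / r * M1 <= s], so the increment of [g] stays in the disc of [f]; the [+ 1]
   keeps the quotient meaningful when [M1 = 0]. *)
pose r' := Num.min r (s * r / (M1 + 1)).
have M11 : 0 < M1 + 1 by rewrite ltr_pwDr.
have r'0 : 0 < r' by rewrite lt_min r0 divr_gt0// mulr_gt0.
have r'r : r' <= r by rewrite ge_min lexx.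
have h1 : psum (fun t => g (x + t) - g x) r' (r' / r * M1).
  by apply: psum_vanish h0 => //; rewrite ?ltW// addr0 subrr.
exists r', N; split=> //.
apply: eq_psum (psum_comp r'0 hf h1 _) => [t _|].
  by rewrite addrC subrK.
rewrite mulrAC ler_pdivrMr//.
have h2 : r' * (M1 + 1) <= s * r by rewrite -ler_pdivlMr// ge_min lexx orbT.
by apply: le_trans h2; rewrite ler_wpM2l ?(ltW r'0)// lerDl.
Qed.

Lemma analytic_psum_ext f g (x : C) d : 0 < d ->
  (forall t, normc t <= d -> f (x + t) = g (x + t)) ->
  analytic_psum f x -> analytic_psum g x.
Proof.
move=> d0 fg [r [M [r0 h]]]; have m0 : 0 < Num.min r d by rewrite lt_min r0.
exists (Num.min r d), M; split=> //.
apply: eq_psum (psum_radius_le (ltW m0) _ h) => [t|]; last by rewrite ge_min lexx.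
by rewrite le_min => /andP[_ /fg].
Qed.

End PowerSeries.

(** * Complex exponential, principal logarithm and argument *)

Section ExpLog.
Variable R : realType.
Implicit Types (z w l s : R[i]) (x y : R).

Lemma cexpE x y : cexp (x +i* y) = (expR x * cos y) +i* (expR x * sin y).
Proof. by rewrite /cexp; simpc. Qed.

Lemma cexp0 : cexp (0 : R[i]) = 1.
Proof. by rewrite cexpE expR0 cos0 sin0 mulr0 mulr1. Qed.

Lemma cexpD z w : cexp (z + w) = cexp z * cexp w.
Proof.
case: z w => a b [c d]; rewrite (_ : (a +i* b) + (c +i* d) = (a + c) +i* (b + d))// !cexpE expRD cosD sinD.
by apply/eqP; rewrite eq_complex/=; apply/andP; split; apply/eqP; ring.
Qed.

Lemma normc_cexp z : normc (cexp z) = expR (complex.Re z).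
Proof.
case: z => a b; rewrite cexpE /= !exprMn -mulrDr cos2Dsin2 mulr1 sqrtr_sqr.
by rewrite ger0_norm// expR_ge0.
Qed.

Lemma cexp_neq0 z : cexp z != 0.
Proof. by rewrite -normc_eq0 normc_cexp gt_eqF// expR_gt0. Qed.

Lemma cexp_mulrn z n : cexp (n%:R * z) = cexp z ^+ n.
Proof.
elim: n => [|n IH]; first by rewrite mul0r cexp0 expr0.
by rewrite -addn1 natrD mulrDl mul1r cexpD IH addn1 exprSr.
Qed.

Lemma clogE z : clog z = ln (normc z) +i* carg z.
Proof. by []. Qed.

Lemma clog_cexp l : - pi < complex.Im l <= pi -> clog (cexp l) = l.
Proof.
move=> /andP[l1 l2]; rewrite clogE normc_cexp expRK.
case: l l1 l2 => a b /= b1 b2; congr (_ +i* _).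
rewrite /carg normcE_Re normc_cexp cexpE /= pmulr_rge0 ?expR_gt0//.
rewrite mulrAC divff ?gt_eqF ?expR_gt0// mul1r.
have [b0|b0] := leP 0 b.
  by rewrite sin_ge0_pi ?b0// cosK// in_itv/= b0.
have sb : sin b < 0 by rewrite -[b]opprK sinN oppr_lt0 sin_gt0_pi// oppr_gt0 b0 ltrNl.
by rewrite leNgt sb/= cosKN ?opprK// (ltW b1) ltW.
Qed.

Section NonZero.
Variable w : R[i].
Hypothesis w0 : w != 0.

Let x := complex.Re w.
Let y := complex.Im w.
Let n := normc w.

Let n0 : 0 < n. Proof. by rewrite normc_gt0. Qed.

Let nE : n ^+ 2 = x ^+ 2 + y ^+ 2.
Proof. by rewrite /n /x /y; case: w => a b /=; rewrite sqr_sqrtr// addr_ge0 ?sqr_ge0. Qed.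

Let xn : -1 <= x / n <= 1.
Proof. by rewrite ler_pdivlMr// mulN1r ler_pdivrMr// mul1r -ler_norml Re_le_normc. Qed.

Lemma cexp_clog : cexp (clog w) = w.
Proof.
rewrite clogE cexpE lnK ?posrE// -/n /carg normcE_Re -/x -/y -/n.
have c : cos (acos (x / n)) = x / n by rewrite acosK.
have s : sin (acos (x / n)) = `|y| / n.
  rewrite sin_acos// (_ : 1 - _ = (y / n) ^+ 2).
    by rewrite sqrtr_sqr normrM normfV (gtr0_norm n0).
  rewrite !exprMn exprVn; have n2 : n ^+ 2 != 0 by rewrite sqrf_eq0 gt_eqF.
  by apply: (mulIf n2); rewrite mulrBl !divfK// mul1r nE addrAC subrr add0r.
rewrite [RHS](_ : w = x +i* y); last by rewrite /x /y; case: w.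
have n00 : n != 0 by rewrite gt_eqF.
case: leP => y0; rewrite ?cosN ?sinN c s.
  by rewrite (ger0_norm y0) ![n * _]mulrC !divfK.
by rewrite (ltr0_norm y0) mulNr opprK ![n * _]mulrC !divfK.
Qed.

(** In the order of [R[i]], [w <= 0] describes the closed negative real axis. An argument of modulus
    [pi] would mean [Re w = - |w|], hence a point of that axis. *)
Lemma carg_lt_pi : ~~ (w <= 0) -> `|carg w| < pi.
Proof.
move=> wN; have a0 := acos_ge0 xn; have a1 : acos (x / n) < pi.
  apply: acos_ltpi; case/andP: xn => xn1 ->; rewrite andbT lt_neqAle xn1 andbT.
  apply: contra wN => /eqP xE; have {}xE : x = - n.
    by rewrite -mulN1r xE divfK// gt_eqF.
  have y2 : y ^+ 2 = 0 by move: nE; rewrite xE sqrrN => /eqP; rewrite -subr_eq0 opprD addNKr oppr_eq0 => /eqP.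
  rewrite lecE /= -/x -/y xE oppr_le0 (ltW n0) andbT eq_sym.
  by move/eqP: y2; rewrite sqrf_eq0.
by rewrite /carg normcE_Re; case: ifP => _; rewrite ?normrN ger0_norm.
Qed.

End NonZero.

(** Both sides have the same exponential, and the bound on the arguments keeps the sum in the
    principal strip, so no multiple of [2 pi i] intervenes. *)
Lemma clogM z w : z != 0 -> w != 0 -> `|carg z + carg w| < pi ->
  clog (z * w) = clog z + clog w.
Proof.
move=> z0 w0; rewrite ltr_norml => /andP[h1 h2].
rewrite -{1}(cexp_clog z0) -{1}(cexp_clog w0) -cexpD clog_cexp//.
by rewrite !clogE /= h1 ltW.
Qed.

Lemma cpowM z w s : z != 0 -> w != 0 -> `|carg z + carg w| < pi ->
  cpow (z * w) s = cpow z s * cpow w s.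
Proof. by move=> z0 w0 h; rewrite /cpow clogM// mulrDr cexpD. Qed.

(** In the right half-plane the argument is an arctangent. This smooth formula is the one
    differentiated in [cder_log]; the arccosine in [carg] is not differentiable on the positive
    axis. *)
Lemma cexp_ln_atan x y : 0 < x ->
  cexp ((ln (x ^+ 2 + y ^+ 2) / 2%:R) +i* atan (y / x)) = x +i* y.
Proof.
move=> x0; have x2 : 0 < x ^+ 2 + y ^+ 2 by rewrite ltr_wpDr ?sqr_ge0// exprn_gt0.
rewrite cexpE; set e := expR _.
have e0 : 0 < e by exact: expR_gt0.
have e2 : e ^+ 2 = x ^+ 2 + y ^+ 2.
  by rewrite -expRM_natl mulrC divfK ?pnatr_eq0// lnK.
have c0 : 0 < cos (atan (y / x)).
  by rewrite cos_atan invr_gt0 sqrtr_gt0 ltr_wpDr ?sqr_ge0.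
have c2 : cos (atan (y / x)) ^+ 2 = (1 + (y / x) ^+ 2)^-1.
  by rewrite cos_atan exprVn sqr_sqrtr// addr_ge0 ?sqr_ge0.
have s : sin (atan (y / x)) = y / x * cos (atan (y / x)).
  by rewrite -{2}[y / x]atanK /tan divfK// gt_eqF.
have ec : e * cos (atan (y / x)) = x.
  apply/eqP; rewrite -(eqrXn2 (n:=2))// ?mulr_ge0// ?ltW//; apply/eqP.
  rewrite exprMn e2 c2; field.
  by rewrite gt_eqF//= gt_eqF.
by rewrite s mulrCA ec divfK// gt_eqF.
Qed.

Lemma clog_halfplane z : 0 < complex.Re z ->
  clog z = (ln (complex.Re z ^+ 2 + complex.Im z ^+ 2) / 2%:R) +i*
           atan (complex.Im z / complex.Re z).
Proof.
case: z => x y /= x0; rewrite -{1}(cexp_ln_atan y x0) clog_cexp//=.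
have pi0 := pi_gt0 R.
have h1 := atan_gtNpi2 (y / x); have h2 := atan_ltpi2 (y / x).
apply/andP; split.
  by apply: lt_trans h1; rewrite ltrN2 gtr_pMr// invf_lt1// ltr1n.
by apply/ltW/(lt_trans h2); rewrite gtr_pMr// invf_lt1// ltr1n.
Qed.

Lemma carg_small (d : R) : 0 < d -> exists2 e : R, 0 < e < 1 &
  forall t : R[i], normc t <= e -> 0 < complex.Re (1 + t) /\ `|carg (1 + t)| < d.
Proof.
move=> d0.
have /cvgrPdist_lt/(_ _ d0)[e /= e0 he] := @continuous_atan R 0.
(* The bound 1/2 keeps [Re (1 + t) >= 1/2]; then [e / 4] makes the quotient [Im / Re] at most
   [e / 2]. *)
pose e' := Num.min (e / 4) 2%:R^-1.
have e'0 : 0 < e' by rewrite lt_min divr_gt0//= invr_gt0.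
have e'1 : e' <= 2%:R^-1 by rewrite ge_min lexx orbT.
have e'2 : e' <= e / 4 by rewrite ge_min lexx.
exists e' => [|t te].
  by rewrite e'0 (le_lt_trans e'1)// invf_lt1// ltr1n.
have t1 := Re_le_normc t; have t2 := Im_le_normc t.
have x0 : 2%:R^-1 <= complex.Re (1 + t).
  rewrite cReD /= -lerBlDl -[leRHS]opprK lerNr.
  rewrite (le_trans (ler_norm _))// normrN (le_trans t1)// (le_trans te)// (le_trans e'1)//.
  lra.
have x00 : 0 < complex.Re (1 + t) by apply: lt_le_trans x0; rewrite invr_gt0.
split=> //.
have -> : carg (1 + t) = complex.Im (clog (1 + t)) by [].
rewrite clog_halfplane//= cImD add0r; set u := _ / _.
have := he u; rewrite /ball_ /= atan0 !sub0r !normrN; apply.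
rewrite normrM normfV (gtr0_norm x00) ltr_pdivrMr//.
apply: le_lt_trans t2 _; apply: le_lt_trans te _.
have : e * 2%:R^-1 <= e * complex.Re (1 + t) by rewrite ler_wpM2l// ltW.
lra.
Qed.

End ExpLog.

(** * A ratio test, and derivatives of complex curves in a real parameter *)

Section Binomial.
Variable R : realType.
Local Notation C := (R[i] : numFieldType).

(** The ratio bound tends to [q], so from some rank on it is below the midpoint [p] of [q] and 1.
    The constant [K] then absorbs the initial terms, and a geometric series dominates. *)
Lemma ratio_test (c : nat -> R) (B q : R) : 0 <= B -> 0 < q < 1 ->
  (forall n, 0 <= c n) ->
  (forall n, c n.+1 <= (B + n%:R) / n.+1%:R * q * c n) -> cvgn (series c).
Proof.
move=> B0 /andP[q0 q1] c0 hc; pose p := (1 + q) / 2%:R.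
have p0 : 0 < p by rewrite /p; lra.
have p1 : p < 1 by rewrite /p; lra.
have qp : 0 < p - q by rewrite /p; lra.
(* [(B + n) * q <= p * (n + 1)] holds as soon as [B * q <= (p - q) * n]. *)
have [N hN] : exists N : nat, B * q / (p - q) < N%:R.
  eexists; apply: archi_boundP; rewrite divr_ge0 ?mulr_ge0//; lra.
have step n : (N <= n)%N -> c n.+1 <= p * c n.
  move=> Nn; apply: le_trans (hc n) _; rewrite ler_wpM2r//.
  rewrite mulrAC ler_pdivrMr ?ltr0Sn// mulrDl.
  have Nn' : N%:R <= n%:R :> R by rewrite ler_nat.
  have : B * q <= (p - q) * n%:R.
    rewrite [leRHS]mulrC -ler_pdivrMr//; apply: le_trans Nn'; exact: ltW.
  rewrite -[n.+1%:R]natr1; lra.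
pose K := \sum_(0 <= k < N.+1) c k / p ^+ k.
have K1 n : (n <= N)%N -> c n <= K * p ^+ n.
  move=> nN; rewrite -ler_pdivrMr ?exprn_gt0// /K big_mkord.
  rewrite (bigD1 (Ordinal (nN : n < N.+1)%N))//= lerDl sumr_ge0// => i _.
  by rewrite divr_ge0// exprn_ge0// ltW.
have cK n : c n <= K * p ^+ n.
  elim: n => [|n IH]; first exact: K1.
  have [nN|nN] := leqP n.+1 N; first exact: K1.
  apply: le_trans (step _ nN) _; rewrite exprS mulrCA ler_wpM2l// ltW//.
have K0 : 0 <= K by rewrite /K sumr_ge0// => i _; rewrite divr_ge0// exprn_ge0// ltW.
apply: (@series_le_cvg _ _ (geometric K p)) => //.
  by move=> n; rewrite /geometric/= mulr_ge0// exprn_ge0// ltW.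
by apply: is_cvg_geometric_series; rewrite ger0_norm// ltW.
Qed.

Definition cder (f : R -> C) (x : R) (d : C) : Prop :=
  is_derive x 1 (fun y => complex.Re (f y)) (complex.Re d) /\
  is_derive x 1 (fun y => complex.Im (f y)) (complex.Im d).

Lemma cderM f g x d e : cder f x d -> cder g x e ->
  cder (fun y => f y * g y) x (d * g x + f x * e).
Proof.
case=> f1 f2 [g1 g2]; split.
  have -> : (fun y => complex.Re (f y * g y)) =
    (fun y => complex.Re (f y)) * (fun y => complex.Re (g y)) -
    (fun y => complex.Im (f y)) * (fun y => complex.Im (g y)).
    by apply/funext => y; rewrite cReM.
  apply: (is_derive_eq (is_deriveB (is_deriveM f1 g1) (is_deriveM f2 g2))).
  rewrite cReD !cReM /GRing.scale/=; ring.
have -> : (fun y => complex.Im (f y * g y)) =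
  (fun y => complex.Re (f y)) * (fun y => complex.Im (g y)) +
  (fun y => complex.Im (f y)) * (fun y => complex.Re (g y)).
  by apply/funext => y; rewrite cImM.
apply: (is_derive_eq (is_deriveD (is_deriveM f1 g2) (is_deriveM f2 g1))).
rewrite cImD !cImM /GRing.scale/=; ring.
Qed.

Lemma cder_cst (c : C) x : cder (fun=> c) x 0.
Proof. by split; exact: is_derive_cst. Qed.

Lemma cder_cexp f x d : cder f x d -> cder (fun y => cexp (f y)) x (cexp (f x) * d).
Proof.
case=> f1 f2.
have e := is_derive1_comp (is_derive_expR (complex.Re (f x))) f1.
have c := is_derive1_comp (is_derive_cos (complex.Im (f x))) f2.
have s := is_derive1_comp (is_derive_sin (complex.Im (f x))) f2.
have fE y : cexp (f y) = (expR (complex.Re (f y)) * cos (complex.Im (f y))) +i*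
   (expR (complex.Re (f y)) * sin (complex.Im (f y))).
  by case: (f y) => a b; rewrite cexpE.
split.
  have -> : (fun y => complex.Re (cexp (f y))) =
    (expR \o (fun y => complex.Re (f y))) * (cos \o (fun y => complex.Im (f y))).
    by apply/funext => y; rewrite fE.
  apply: (is_derive_eq (is_deriveM e c)).
  rewrite cReM fE /GRing.scale/=; ring.
have -> : (fun y => complex.Im (cexp (f y))) =
  (expR \o (fun y => complex.Re (f y))) * (sin \o (fun y => complex.Im (f y))).
  by apply/funext => y; rewrite fE.
apply: (is_derive_eq (is_deriveM e s)).
rewrite cImM fE /GRing.scale/=; ring.
Qed.

Lemma cder0_cst f (a b : R) : a <= b ->
  (forall x, a <= x <= b -> cder f x 0) -> f b = f a.
Proof.
move=> ab h.
have H (g : R -> R) : (forall x, a <= x <= b -> is_derive x 1 g 0) -> g b = g a.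
  move=> hg; have [||c _] := @MVT_segment _ g (fun=> 0) a b ab.
  - by move=> x; rewrite in_itv/= => /andP[/ltW x1 /ltW x2]; apply: hg; rewrite x1.
  - apply: derivable_within_continuous => x; rewrite in_itv/= => /hg k.
    exact: ex_derive.
  by rewrite mul0r => /eqP; rewrite subr_eq0 => /eqP.
have h1 := H _ (fun x hx => (h x hx).1); have h2 := H _ (fun x hx => (h x hx).2).
by apply/eqP; rewrite eq_complex h1 h2 !eqxx.
Qed.

Lemma is_derive_mulr (c x : R) : is_derive x 1 (fun y : R => y * c) c.
Proof.
apply: (is_derive_eq (is_deriveM (is_derive_id (x : R) (1 : R)) (is_derive_cst (c : R) (x : R) (1 : R)))).
by rewrite /GRing.scale/= mulr0 add0r mulr1.
Qed.

(** The curve is [clog (1 + y t)] in its half-plane form, and the derivative is the expected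
    [t / (1 + x t)]. *)
Lemma cder_log (t : C) (x : R) : 0 < 1 + x * complex.Re t ->
  cder (fun y => (ln ((1 + y * complex.Re t) ^+ 2 + (y * complex.Im t) ^+ 2) / 2%:R) +i*
           atan ((y * complex.Im t) / (1 + y * complex.Re t))) x (t / (1 + x%:C * t)).
Proof.
case: t => p q /= x0.
have s0 : 0 < (1 + x * p) ^+ 2 + (x * q) ^+ 2.
  by rewrite ltr_wpDr ?sqr_ge0// exprn_gt0.
have dv := is_derive_mulr q x.
have du : is_derive x 1 (fun y : R => 1 + y * p) p.
  exact: (is_derive_eq (is_deriveD (is_derive_cst (1 : R) (x : R) (1 : R)) (is_derive_mulr p x)) (add0r p)).
have ds : is_derive x 1 (fun y : R => (1 + y * p) ^+ 2 + (y * q) ^+ 2)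
    (2 * (1 + x * p) * p + 2 * (x * q) * q).
  have -> : (fun y : R => (1 + y * p) ^+ 2 + (y * q) ^+ 2) =
    (fun y => 1 + y * p) * (fun y => 1 + y * p) + (fun y => y * q) * (fun y => y * q).
    by apply/funext => y; rewrite !expr2.
  apply: (is_derive_eq (is_deriveD (is_deriveM du du) (is_deriveM dv dv))).
  by rewrite /GRing.scale/=; ring.
have dl := @is_derive1_comp R (@ln R) (fun y : R => (1 + y * p) ^+ 2 + (y * q) ^+ 2) x _ _ (is_derive1_ln s0) ds.
have x00 : 1 + x * p != 0 by rewrite gt_eqF.
have di := is_deriveV (f := fun y : R => 1 + y * p) x00 du.
have da := @is_derive1_comp R (@atan R) (fun y : R => y * q / (1 + y * p)) x _ _ (is_derive1_atan (x * q / (1 + x * p))) (is_deriveM dv di).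
have s00 : (1 + x * p) ^+ 2 + (x * q) ^+ 2 != 0 by rewrite gt_eqF.
have dE : (p +i* q) / (1 + x%:C * (p +i* q)) =
  (((1 + x * p) * p + (x * q) * q) / ((1 + x * p) ^+ 2 + (x * q) ^+ 2)) +i*
  (((1 + x * p) * q - (x * q) * p) / ((1 + x * p) ^+ 2 + (x * q) ^+ 2)).
  have z0 : 1 + x%:C * (p +i* q) != 0.
    by apply/eqP => /(congr1 (@complex.Re R)) /=; rewrite mul0r subr0; apply/eqP.
  apply: (mulIf z0); rewrite divfK//; apply/eqP; rewrite eq_complex /=.
  by apply/andP; split; apply/eqP; field.
rewrite dE; split => /=.
  have -> : (fun y : R => ln ((1 + y * p) ^+ 2 + (y * q) ^+ 2) / 2%:R) =
    (@ln R \o (fun y : R => (1 + y * p) ^+ 2 + (y * q) ^+ 2)) * cst 2%:R^-1 by apply/funext.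
  apply: (is_derive_eq (is_deriveM dl (is_derive_cst (2%:R^-1 : R) (x : R) (1 : R)))).
  by rewrite /GRing.scale/=; field.
apply: (is_derive_eq (da)).
rewrite /GRing.scale/=; field.
by rewrite x00 s00.
Qed.

End Binomial.

(** * The binomial series and the analyticity of complex powers *)

Section BinomialSeries.
Variable R : realType.
Local Notation C := (R[i] : numFieldType).

Lemma Re_realX (c : C) (x : R) n : complex.Re (c * x%:C ^+ n) = complex.Re c * x ^+ n.
Proof. by rewrite -rmorphXn cReM /= mulr0 subr0. Qed.

Lemma Im_realX (c : C) (x : R) n : complex.Im (c * x%:C ^+ n) = complex.Im c * x ^+ n.
Proof. by rewrite -rmorphXn cImM /= mulr0 add0r. Qed.

(** Termwise differentiation on the real line asks for convergence at [K] of the series and of its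
    first two formal derivatives. Stated with moduli, the three hypotheses serve the real and
    imaginary parts alike. *)
Lemma cder_pseries (c : nat -> C) (K : R) : 0 < K ->
  cvgn (series (fun n => normc (c n) * K ^+ n)) ->
  cvgn (series (fun n => n.+1%:R * normc (c n.+1) * K ^+ n)) ->
  cvgn (series (fun n => n.+1%:R * (n.+2%:R * normc (c n.+2)) * K ^+ n)) ->
  exists F F' : R -> C, forall x, `|x| < K ->
    [/\ hsum (fun n => c n * x%:C ^+ n) (F x),
        hsum (fun n => n.+1%:R * c n.+1 * x%:C ^+ n) (F' x) &
        cder F x (F' x)].
Proof.
move=> K0 h0 h1 h2.
have cv (u : nat -> R) (v : nat -> R) : (forall n, `|u n| <= v n) ->
    cvgn (series (fun n => v n * K ^+ n)) -> cvgn (pseries u K).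
  move=> uv hv; apply: normed_cvg; apply: series_le_cvg hv => n /=.
  - exact: normr_ge0.
  - by rewrite mulr_ge0 ?exprn_ge0 ?(ltW K0)// (le_trans (normr_ge0 (u n))).
  - by rewrite normrM normrX (gtr0_norm K0) ler_wpM2r ?exprn_ge0 ?(ltW K0).
have H (f : C -> R) : (forall z, `|f z| <= normc z) ->
  [/\ cvgn (pseries (fun n => f (c n)) K),
      cvgn (pseries (pseries_diffs (fun n => f (c n))) K) &
      cvgn (pseries (pseries_diffs (pseries_diffs (fun n => f (c n)))) K)].
  move=> fz; split.
  - exact: cv h0.
  - by apply: cv h1 => n; rewrite /pseries_diffs normrM normr_nat ler_wpM2l.
  - apply: cv h2 => n; rewrite /pseries_diffs !normrM !normr_nat.
    by rewrite !ler_wpM2l.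
have [p0 p1 p2] := H _ (@Re_le_normc R).
have [q0 q1 q2] := H _ (@Im_le_normc R).
pose p n := complex.Re (c n); pose q n := complex.Im (c n).
exists (fun x => limn (pseries p x) +i* limn (pseries q x)).
exists (fun x => limn (pseries (pseries_diffs p) x) +i* limn (pseries (pseries_diffs q) x)).
move=> x; rewrite -{1}(gtr0_norm K0) => xK; split.
- apply: hsum_ReIm => /=.
    under eq_fun do rewrite Re_realX; exact: (is_cvg_pseries_inside p0 xK).
  under eq_fun do rewrite Im_realX; exact: (is_cvg_pseries_inside q0 xK).
- apply: hsum_ReIm => /=.
    have -> : (fun n => complex.Re (n.+1%:R * c n.+1 * x%:C ^+ n)) =
        (fun n => pseries_diffs p n * x ^+ n).
      apply/funext => n; rewrite Re_realX /pseries_diffs /p; congr (_ * _).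
      by rewrite -(rmorph_nat (real_complex R)) cReM /= mul0r subr0.
    exact: (is_cvg_pseries_inside p1 xK).
  have -> : (fun n => complex.Im (n.+1%:R * c n.+1 * x%:C ^+ n)) =
      (fun n => pseries_diffs q n * x ^+ n).
    apply/funext => n; rewrite Im_realX /pseries_diffs /q; congr (_ * _).
    by rewrite -(rmorph_nat (real_complex R)) cImM /= mul0r addr0.
  exact: (is_cvg_pseries_inside q1 xK).
- split => /=; exact: pseries_snd_diffs xK.
Qed.

(** This is the binomial coefficient of [-b] over [n]. *)
Definition bcoef (b : C) (n : nat) : C := rising b n * (-1) ^+ n / n`!%:R.

Lemma bcoef0 b : bcoef b 0 = 1.
Proof. by rewrite /bcoef /rising big_ord0 expr0 fact0 divr1 mulr1. Qed.

Lemma bcoefS b n : n.+1%:R * bcoef b n.+1 = - (b + n%:R) * bcoef b n.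
Proof.
rewrite /bcoef risingSr exprS factS natrM; field.
by rewrite addrC natr1 !pnatr_eq0/= -lt0n fact_gt0.
Qed.

Lemma normc_bcoefS b n (t : C) :
  n.+1%:R * normc (bcoef b n.+1 * t ^+ n.+1) =
  normc (b + n%:R) * normc t * normc (bcoef b n * t ^+ n).
Proof.
rewrite -(normc_nat R n.+1) -!normcM mulrA bcoefS exprS mulNr.
by rewrite mulNr normc_opp; congr normc; ring.
Qed.

Lemma normcD_nat (b : C) n m : normc (b + (n + m)%:R) <= (normc b + m%:R) + n%:R.
Proof.
apply: le_trans (normcD_le _ _) _; rewrite normc_nat natrD; lra.
Qed.

Section Bounds.
Variables (b t : C) (K : R).
Hypotheses (K0 : 0 < K) (Kt : K * normc t < 1).

Let q := (1 + K * normc t) / 2%:R.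

Let q01 : 0 < q < 1.
Proof.
have h : 0 <= K * normc t by rewrite mulr_ge0 ?(ltW K0)// normc_ge0.
by rewrite /q; move: (K * normc t) h Kt => y *; apply/andP; split; lra.
Qed.

Let c n := normc (bcoef b n * t ^+ n).

Let cS n : n.+1%:R * c n.+1 = normc (b + n%:R) * normc t * c n.
Proof. exact: normc_bcoefS. Qed.

(** Here [j] counts formal derivatives: each one shifts [b + n] to [b + n + 1] in the ratio, which
    only enlarges the constant [B] of the ratio test. *)
Let step (d : nat -> R) j : (forall n, 0 <= d n) ->
  (forall n, n.+1%:R * d n.+1 = normc (b + (n + j)%:R) * (K * normc t) * d n) ->
  cvgn (series d).
Proof.
have B0 : 0 <= normc b + j%:R by rewrite addr_ge0// normc_ge0.
move=> d0 dS; apply: (ratio_test B0 q01 d0) => n.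
have n0 : (0 : R) < n.+1%:R by rewrite ltr0n.
rewrite -(ler_pM2l n0) dS [leRHS]mulrA ler_wpM2r//.
rewrite (_ : n.+1%:R * _ = (normc b + j%:R + n%:R) * q); last first.
  by rewrite mulrA [X in X * q]mulrC divfK// gt_eqF.
rewrite ler_pM ?normc_ge0//.
- by rewrite mulr_ge0 ?(ltW K0)// normc_ge0.
- exact: normcD_nat.
- by rewrite /q; move: (K * normc t) Kt => y *; lra.
Qed.

Lemma cvg_bcoef0 : cvgn (series (fun n => c n * K ^+ n)).
Proof.
apply: (step (j := 0)) => n.
  by rewrite mulr_ge0 ?normc_ge0// exprn_ge0// ltW.
by rewrite addn0 [LHS]mulrA cS exprS; ring.
Qed.

Lemma cvg_bcoef1 : cvgn (series (fun n => n.+1%:R * c n.+1 * K ^+ n)).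
Proof.
apply: (step (j := 1)) => n.
  by rewrite !mulr_ge0 ?normc_ge0// exprn_ge0// ltW.
by rewrite addn1 cS exprS; ring.
Qed.

Lemma cvg_bcoef2 : cvgn (series (fun n => n.+1%:R * (n.+2%:R * c n.+2) * K ^+ n)).
Proof.
apply: (step (j := 2)) => n.
  by rewrite !mulr_ge0 ?normc_ge0// exprn_ge0// ltW.
by rewrite addn2 cS exprS; ring.
Qed.

End Bounds.

(** For real [x] in [0, 1], the sum [F x] of the series at [x t] satisfies [(1 + x t) F' = - b t F].
    Hence [F x * exp (b log (1 + x t))] has zero derivative and keeps its value 1 from [x = 0] to
    [x = 1]. *)
Lemma hsum_binomial (b t : C) : normc t < 1 ->
  hsum (fun n => bcoef b n * t ^+ n) (cpow (1 + t) (- b)).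
Proof.
move=> t1; have t0 := normc_ge0 t.
(* Any [K] with [1 < K] and [K |t| < 1] would do: the endpoint [x = 1] must lie strictly inside the
   interval of convergence. *)
pose K := 2%:R / (1 + normc t).
have K1 : 1 < K by rewrite ltr_pdivlMr; lra.
have K0 : 0 < K by lra.
have Kt : K * normc t < 1.
  by rewrite mulrAC ltr_pdivrMr; lra.
have [F [F' HF]] := cder_pseries K0 (@cvg_bcoef0 b t K K0 Kt) (@cvg_bcoef1 b t K K0 Kt) (@cvg_bcoef2 b t K K0 Kt).
have RtN : - 1 < complex.Re t.
  by move: (Re_le_normc t); rewrite ler_norml => /andP[h _]; lra.
have pos x : 0 <= x <= 1 -> 0 < 1 + x * complex.Re t.
  case/andP => x0 x1; have [r0|r0] := leP 0 (complex.Re t).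
    by rewrite ltr_pwDl// mulr_ge0.
  have : complex.Re t <= x * complex.Re t by rewrite -{1}[complex.Re t]mul1r ler_wnM2r// ltW.
  lra.
pose Lg (x : R) : C := (ln ((1 + x * complex.Re t) ^+ 2 + (x * complex.Im t) ^+ 2) / 2%:R) +i*
   atan ((x * complex.Im t) / (1 + x * complex.Re t)).
have nz x : 0 <= x <= 1 -> 1 + x%:C * t != 0.
  move=> /pos h; apply/eqP => /(congr1 (@complex.Re R)).
  by rewrite cReD cReM /= mul0r subr0 => e; move: h; rewrite e ltxx.
have dE x : 0 <= x <= 1 -> cder (fun y => F y * cexp (b * Lg y)) x 0.
  move=> x01; have xK : `|x| < K.
    by case/andP: x01 => x0 x1; rewrite ger0_norm//; apply: le_lt_trans K1.
  have [h1 h2 h3] := HF x xK.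
  have d1 := cder_cexp (cderM (cder_cst b x) (cder_log (pos x x01))).
  have d2 := cderM h3 d1.
  (* Coefficientwise this is [bcoefS], the product by [x t] being a shift by one index. *)
  have ode : F' x + x%:C * t * F' x = - b * t * F x.
    apply: (hsum_unique (hsumD h2 (hsum_shift 1 (hsumMl (x%:C * t) h2)))).
    apply: eq_hsum (hsumMl (- b * t) h1) => // -[|n].
      have := bcoefS b 0; rewrite mul1r addr0 => bS.
      by rewrite /= bS !expr0 expr1 addr0; ring.
    have bS := bcoefS b n.+1.
    rewrite [n.+2%:R * _]mulrA bS subn1 /= !exprS; ring.
  suff <- : F' x * cexp (b * Lg x) + F x * (cexp (b * Lg x) * (0 * Lg x + b * (t / (1 + x%:C * t)))) = 0 by [].
  have -> : F' x = - b * t * F x / (1 + x%:C * t).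
    by rewrite -ode; field; exact: nz.
  field; exact: nz.
have F0 : F 0 = 1.
  have [|h _ _] := HF 0; first by rewrite normr0.
  apply: (hsum_unique h).
  have := hsum_fin (m := 1) (u := fun n => bcoef b n * t ^+ n * 0%:C ^+ n).
  rewrite big_nat1 bcoef0 !expr0 !mulr1; apply.
  by case=> // n _; rewrite expr0n mulr0.
have Lg0 : Lg 0 = 0.
  by rewrite /Lg !mul0r addr0 expr1n expr0n/= addr0 ln1 mul0r atan0.
have Lg1 : Lg 1 = clog (1 + t).
  rewrite clog_halfplane ?cReD ?cImD /=; last by lra.
  by rewrite /Lg !mul1r add0r.
have := cder0_cst (@ler01 R) dE; rewrite F0 Lg0 mulr0 cexp0 mulr1 Lg1 => F1.
have [|h _ _] := HF 1; first by rewrite normr1.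
apply: eq_hsum h => [n|]; first by rewrite expr1n mulr1.
apply: (mulIf (cexp_neq0 (b * clog (1 + t)))); rewrite F1 /cpow -cexpD mulNr addNr.
by rewrite cexp0.
Qed.

Lemma analytic_psum_cpow1 (s : C) : analytic_psum (fun w => cpow (1 + w) s) 0.
Proof.
have h2 : (0 : R) < 2%:R^-1 by rewrite invr_gt0.
have K1 : 1 * normc (2%:R^-1 : C) < 1.
  by rewrite mul1r normcV normc_nat invf_lt1// ltr1n.
have cv := @cvg_bcoef0 (- s) _ 1 (@ltr01 R) K1.
exists 2%:R^-1, (limn (series (fun n => normc (bcoef (- s) n * 2%:R^-1 ^+ n) * 1 ^+ n))).
split=> //; exists (bcoef (- s)) => [n|t t2].
  have u0 n' : 0 <= normc (bcoef (- s) n' * 2%:R^-1 ^+ n') * 1 ^+ n'.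
    by rewrite expr1n mulr1 normc_ge0.
  have := nondecreasing_cvgn_le (nondecreasing_series (fun n _ _ => u0 n)) cv n.
  apply: le_trans; rewrite /series/=; apply: ler_sum => i _.
  by rewrite expr1n mulr1 (normcM (bcoef (- s) i)) normcX normcV normc_nat.
rewrite add0r -{2}(opprK s); apply: hsum_binomial.
by apply: le_lt_trans t2 _; rewrite invf_lt1// ltr1n.
Qed.

(** Near [v], write [w = v * (1 + (w / v - 1))]. The second factor has an argument below the margin
    [pi - |carg v|], so the power of the product splits and the binomial series at 1 applies. *)
Lemma analytic_psum_cpow (v s : C) : ~~ (v <= 0) -> analytic_psum (fun w => cpow w s) v.
Proof.
move=> vN; have v0 : v != 0 by apply: contra vN => /eqP->.
have := carg_lt_pi v0 vN; rewrite -subr_gt0 => d0.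
have [e /andP[e0 e1] he] := carg_small d0.
apply: (@analytic_psum_ext _ (fun w => cpow v s * cpow (1 + (v^-1 * w + -1)) s) _ _ (e * normc v)).
- by rewrite mulr_gt0// normc_gt0.
- move=> t te; have tv : normc (v^-1 * t) <= e.
    by rewrite normcM normcV mulrC ler_pdivrMr// normc_gt0.
  have [x0 ce] := he _ tv.
  rewrite (_ : 1 + (v^-1 * (v + t) + -1) = 1 + v^-1 * t); last by field.
  rewrite -cpowM//.
  - by rewrite mulrDr mulr1 mulVKf.
  - by apply/eqP => h; move: x0; rewrite h ltxx.
  - by apply: le_lt_trans (ler_normD _ _) _; rewrite addrC -ltrBrDr.
apply: analytic_psumM; first exact: analytic_psum_cst.
apply: (analytic_psum_comp (f := fun w => cpow (1 + w) s) (g := fun w => v^-1 * w + -1)).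
  by rewrite mulVf// subrr; exact: analytic_psum_cpow1.
apply: analytic_psumD; last exact: analytic_psum_cst.
by apply: analytic_psumM; [exact: analytic_psum_cst|exact: analytic_psum_id].
Qed.

Lemma cpow_half_sqr (w : C) : w != 0 -> cpow w (2%:R^-1) ^+ 2 = w.
Proof.
by move=> w0; rewrite /cpow -cexp_mulrn mulrA divff ?pnatr_eq0// mul1r cexp_clog.
Qed.

Lemma cpow1 (s : C) : cpow (1 : R[i]) s = 1.
Proof.
have l0 : clog (1 : R[i]) = 0.
  rewrite -(cexp0 R) clog_cexp//=.
  by rewrite oppr_lt0 pi_gt0 pi_ge0.
by rewrite /cpow l0 mulr0 cexp0.
Qed.

End BinomialSeries.

(** * The identity theorem along segments and uniqueness of the continuation *)

Section Identity.
Variable R : realType.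
Local Notation C := (R[i] : numFieldType).
Implicit Types (f g : C -> C) (u : nat -> C).

Lemma nearcP (P : C -> Prop) (x : C) :
  (\forall y \near x, P y) <-> exists2 e : R, 0 < e & forall y, normc (y - x) < e -> P y.
Proof.
split.
  move=> /nbhs_ballP[[e e'] /=]; rewrite ltcE/= => /andP[/eqP-> e0] h.
  exists e => // y yx; apply: h; rewrite -ball_normE /ball_/= normr_normc ltcR.
  by rewrite normcB_sym.
case=> e e0 h; apply/nbhs_ballP; exists e%:C; first by rewrite /= ltcR.
by move=> y; rewrite -ball_normE /ball_/= normr_normc ltcR normcB_sym; exact: h.
Qed.

Lemma sum_half_le (n : nat) : \sum_(0 <= k < n) (2%:R^-1 : R) ^+ k <= 2%:R.
Proof.
suff -> : \sum_(0 <= k < n) (2%:R^-1 : R) ^+ k = 2%:R - 2%:R * 2%:R^-1 ^+ n.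
  by rewrite gerBl mulr_ge0// exprn_ge0// invr_ge0.
elim: n => [|n IH]; first by rewrite big_nil expr0; ring.
by rewrite big_nat_recr//= IH exprS; field.
Qed.

(** A power series with nonzero zeros arbitrarily close to 0. The property survives removal of a
    vanishing constant term, which is what the induction in [frequently_nullP] uses. *)
Definition frequently_null u := exists r B : R,
  [/\ 0 < r, forall n, normc (u n) * r ^+ n <= B &
      forall e : R, 0 < e -> exists2 d : C, 0 < normc d < e & hsum (fun n => u n * d ^+ n) 0].

Lemma frequently_null0 u : frequently_null u -> u 0%N = 0.
Proof.
move=> [r [B [r0 uB H]]]; apply/eqP; rewrite -normc_eq0; apply/eqP/le_anti.
rewrite normc_ge0 andbT; have B0 : 0 <= B.
  by apply: le_trans (uB 0%N); rewrite expr0 mulr1 normc_ge0.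
apply/ler_addgt0Pr => e e0; rewrite add0r.
(* At a zero [d], [u 0] is minus the rest of the series. With [|d| <= r / 2] that rest is at most
   [|d| / r * 2B] by a geometric sum, and the second bound brings this below [e]. *)
have e1 : 0 < Num.min (r / 2%:R) (e * r / (2%:R * B + 1)).
  by rewrite lt_min !divr_gt0// ?mulr_gt0// ltr_wpDl// mulr_ge0.
have [d /andP[d0 de] hd] := H _ e1.
move: de; rewrite lt_min => /andP[de1 de2].
have := hsum_behead hd; rewrite expr0 mulr1 sub0r => h.
have q0 : 0 <= normc d / r by apply: divr_ge0; [exact: normc_ge0|exact: ltW].
rewrite -normc_opp.
apply: (@le_trans _ _ (normc d / r * (2%:R * B))); last first.
  rewrite mulrAC ler_pdivrMr//.
  apply: (@le_trans _ _ (normc d * (2%:R * B + 1))).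
    by rewrite ler_wpM2l ?normc_ge0// lerDl.
  by rewrite -ler_pdivlMr ?ltW// ltr_wpDl// mulr_ge0.
apply: hsum_normc_le h => n.
apply: (@le_trans _ _ (\sum_(0 <= k < n) (normc d / r * B * 2%:R^-1 ^+ k))); last first.
  rewrite -mulr_sumr -mulrA; apply: ler_wpM2l => //; rewrite [leRHS]mulrC.
  by apply: ler_wpM2l => //; exact: sum_half_le.
apply: ler_sum => k _; rewrite normcM normcX.
have -> : normc d ^+ k.+1 = (normc d / r) ^+ k.+1 * r ^+ k.+1.
  by rewrite -exprMn divfK// gt_eqF.
rewrite mulrCA exprS; set q := normc d / r in q0 *.
rewrite -[q * q ^+ k * _]mulrA -[leRHS]mulrA; apply: ler_wpM2l => //.
rewrite mulrC; apply: ler_pM => //.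
- by rewrite mulr_ge0 ?normc_ge0// exprn_ge0// ltW.
- exact: exprn_ge0.
apply: lerXn2r; rewrite ?nnegrE ?invr_ge0//.
by rewrite ler_pdivrMr// mulrC ltW.
Qed.

Lemma frequently_nullP u : frequently_null u -> forall n, u n = 0.
Proof.
move=> hu n; elim: n u hu => [|n IH] u hu; first exact: frequently_null0.
apply: (IH (fun n => u n.+1)).
have u0 := frequently_null0 hu; have [r [B [r0 uB H]]] := hu.
exists r, (B / r); split=> // [k|e e0].
  by rewrite ler_pdivlMr// -mulrA -exprSr.
have [d de hd] := H _ e0; exists d => //.
have d0 : d != 0 by rewrite -normc_gt0; case/andP: de.
have := hsumMl d^-1 (hsum_behead hd); rewrite u0 mul0r subr0 mulr0.
apply: eq_hsum => // k; rewrite exprS.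
by rewrite mulrCA; congr (_ * _); rewrite mulrA mulVf// mul1r.
Qed.

Lemma hsum_bounded u (r : R) (l : C) : 0 < r -> hsum (fun n => u n * r%:C ^+ n) l ->
  exists B, forall n, normc (u n) * r ^+ n <= B.
Proof.
move=> r0 [hl].
have h0 : (fun n => u n * r%:C ^+ n) @ \oo --> (0 : C).
  by apply: (@cvg_series_cvg_0 C C); apply/cvg_ex; exists l; exact: hl.
have h1 := cvgc_normc h0.
have cv : cvgn (fun n => normc (u n * r%:C ^+ n)) by apply/cvg_ex; eexists; exact: h1.
have /pinfty_ex_gt0[B B0 hB] := cvg_seq_bounded cv.
exists B => n; have := hB n Logic.I; rewrite /=.
by rewrite ger0_norm ?normc_ge0// normcM normcX normc_real// ltW.
Qed.

Lemma analytic_eq_near f g (x : C) : analytic_at f x -> analytic_at g x ->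
  (forall e : R, 0 < e -> exists2 y : C, 0 < normc (y - x) < e & f y = g y) ->
  exists2 e : R, 0 < e & forall y, normc (y - x) < e -> f y = g y.
Proof.
move=> [u /nearcP[d1 d10 h1]] [v /nearcP[d2 d20 h2]] H.
pose d := Num.min d1 d2; have d0 : 0 < d by rewrite lt_min d10.
have hw y : normc (y - x) < d ->
    hsum (fun n => (u n - v n) * (y - x) ^+ n) (f y - g y).
  rewrite lt_min => /andP[yd1 yd2].
  have a1 : hsum (fun n => u n * (y - x) ^+ n) (f y) by split; exact: h1.
  have a2 : hsum (fun n => v n * (y - x) ^+ n) (g y) by split; exact: h2.
  by apply: eq_hsum (hsumB a1 a2) => // n; rewrite mulrBl.
exists d => // y yd.
have w0 : forall n, u n - v n = 0.
  apply: frequently_nullP.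
  have d2' : 0 < d / 2%:R by rewrite divr_gt0.
  (* Convergence at the single point [x + d / 2] bounds the coefficients at radius [d / 2]. *)
  have dx : (x + (d / 2%:R)%:C) - x = (d / 2%:R)%:C by rewrite addrC addKr.
  have hx : normc ((x + (d / 2%:R)%:C) - x) < d.
    by rewrite dx normc_real ?ltW// ltr_pdivrMr// ltr_pMr// ltr1n.
  have := hw _ hx; rewrite dx => hd; have [B hB] := hsum_bounded d2' hd.
  exists (d / 2%:R), B; split=> // e e0.
  have m0 : 0 < Num.min d e by rewrite lt_min d0.
  have [z /andP[z0]] := H _ m0; rewrite lt_min => /andP[zd ze] fg.
  exists (z - x); first by rewrite z0.
  by have := hw _ zd; rewrite fg subrr.
apply/eqP; rewrite -subr_eq0; apply/eqP.
apply: (hsum_unique (hw y yd)); apply: eq_hsum (hsum0 R) => // n.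
by rewrite w0 mul0r.
Qed.

Lemma analytic_eq_segment f g (w : C) :
  (forall t : R, 0 <= t <= 1 -> analytic_at f (t%:C * w) /\ analytic_at g (t%:C * w)) ->
  (exists2 e : R, 0 < e & forall y, normc y < e -> f y = g y) -> f w = g w.
Proof.
move=> an [e0 e00 he0].
have [->|w0] := eqVneq w 0; first by apply: he0; rewrite normc0.
have nw : 0 < normc w by rewrite normc_gt0.
(* Parameters near whose point the two functions agree on a whole disc: open by construction,
   containing 0, and closed in [0, 1] by the local identity theorem. *)
pose U := [set t : R | exists2 e : R, 0 < e & forall y, normc (y - t%:C * w) < e -> f y = g y].
have Uo : open U.
  rewrite openE => t [e ep he]; rewrite /interior; apply/nbhs_ballP.
  exists (e / 2%:R / normc w); first by rewrite /= !divr_gt0.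
  move=> s; rewrite /ball/= => ts; exists (e / 2%:R); first by rewrite divr_gt0.
  move=> y ys; apply: he.
  have -> : y - t%:C * w = (y - s%:C * w) + (s - t)%:C * w.
    by rewrite rmorphB /=; ring.
  apply: le_lt_trans (normcD_le _ _) _; rewrite [ltRHS]splitr ltrD//.
  rewrite normcM -ltr_pdivlMr// (_ : normc (s - t)%:C = `|t - s|)//.
  by rewrite /= expr0n/= addr0 sqrtr_sqr distrC.
have Ucl t : 0 <= t <= 1 -> closure U t -> U t.
  move=> t01 clt; have [a1 a2] := an t t01.
  (* Assuming [t] outside [U] ensures that the nearby [s] in [U] differs from [t], as the punctured
     disc of [analytic_eq_near] requires. *)
  case: (pselect (U t)) => [//|Ut]; apply: (analytic_eq_near a1 a2) => e ep.
  have e' : 0 < e / normc w by rewrite divr_gt0.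
  have [s [[d d0 Us]]] := clt _ (nbhsx_ballx t _ e'); rewrite /ball/= => ts.
  exists (s%:C * w); last by apply: Us; rewrite subrr normc0.
  have -> : s%:C * w - t%:C * w = (s - t)%:C * w by rewrite rmorphB mulrBl.
  rewrite normcM -ltr_pdivlMr// (_ : normc (s - t)%:C = `|t - s|)//; last first.
    by rewrite /= expr0n/= addr0 sqrtr_sqr distrC.
  rewrite ts andbT mulr_gt0// normr_gt0 subr_eq0; apply/eqP => st; apply: Ut; rewrite st.
  by exists d.
have : `[0, 1] `&` U = `[0, 1]%classic.
  apply: (@segment_connected R 0 1).
  - exists 0; split; first by rewrite /= in_itv/= lexx ler01.
    by exists e0 => // y; rewrite mul0r subr0; exact: he0.
  - by exists U.
  - exists (closure U); first exact: closed_closure.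
    apply/seteqP; split=> t [t1 t2]; split=> //; first exact: subset_closure.
    by apply: Ucl => //; move: t1; rewrite /= in_itv.
move=> /seteqP[_ /(_ 1)][]; first by rewrite /= in_itv/= lexx ler01.
by move=> _ [e ep]; apply; rewrite mul1r subrr normc0.
Qed.

(** The slit plane is star-shaped about 0, since dividing a point of the half-line by a [t] in ]0,
    1] keeps it there. *)
Lemma segment_slit (t : R) (w : C) : 0 <= t <= 1 -> w \notin `[1, +oo[ ->
  t%:C * w \notin `[1, +oo[.
Proof.
move=> /andP[t0 t1]; apply: contra; rewrite !in_itv/= !andbT.
rewrite !lecE cReM cImM /= !mul0r subr0 addr0 => /andP[/eqP tw w1].
have {}t0 : 0 < t by rewrite lt_neqAle t0 andbT; apply: contraTneq w1 => <-; rewrite mul0r ler10.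
have -> : complex.Im w = 0.
  by move: tw => /eqP; rewrite mulf_eq0 gt_eqF//= => /eqP.
rewrite eqxx/= (le_trans w1)// ler_piMl//.
have : 0 < t * complex.Re w by exact: lt_le_trans w1.
by rewrite pmulr_rgt0// => /ltW.
Qed.

(** The witness [f] rules out the default value of [xget]; the chosen function and [f] then share
    their series on the unit disc, and the segment from 0 to [w] does the rest. *)
Lemma hyp2F1_unique (a b c : C) f (w : C) : is_hyp2F1 a b c f ->
  w \notin `[1, +oo[ -> hyp2F1 a b c w = f w.
Proof.
move=> hf hw; rewrite /hyp2F1; set g := xget _ _.
have [g1 g2] : is_hyp2F1 a b c g by rewrite /g; case: xgetP => [_ _ //|/(_ f)/(_ hf)].
have [f1 f2] := hf.
apply: analytic_eq_segment => [t t01|].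
  by split; [apply: g2|apply: f2]; exact: segment_slit.
exists 1 => // y y1; have y1' : `|y| < 1 by rewrite normr_normc -[1]/(1%:C) ltcR.
exact: cvgc_unique (g1 y y1') (f1 y y1').
Qed.

End Identity.

(** * The closed form: its power series, its analyticity, and the conclusion *)

Section ClosedForm.
Variables (R : realType) (m : nat) (a : R[i]).
Local Notation C := (R[i] : numFieldType).
Implicit Types (z w : C).

(** Half of the bracket of the theorem. The other half is [gterm l (- z)], the sign [(-1)^l] of the
    falling factorial being absorbed by [(- z) ^+ l]; evenness is then visible. *)
Definition gterm l z : C := rising (2%:R * a) l * cpow (1 + z) (- 2%:R * a - l%:R) * z ^+ l.

Definition prefactor : C := 1 / 2%:R ^+ m.+1 * (m`!%:R / (odd_dfact m)%:R).

Definition weight k : C := 2%:R ^+ k / k`!%:R * 'C(2 * m - 2 * k, m - k)%:R.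

Definition closed_form z : C :=
  prefactor * \sum_(0 <= k < m.+1) weight k *
    \sum_(0 <= l < k.+1) qcoef _ k l * (gterm l z + gterm l (- z)).

Lemma closed_formN z : closed_form (- z) = closed_form z.
Proof.
rewrite /closed_form; congr (_ * _); apply: eq_bigr => k _; congr (_ * _).
by apply: eq_bigr => l _; rewrite opprK addrC.
Qed.

Lemma closed_form_sqr z w : z ^+ 2 = w ^+ 2 -> closed_form z = closed_form w.
Proof. by move/eqP; rewrite eqf_sqr => /orP[] /eqP->; [|exact: closed_formN]. Qed.

(** Up to the sign [(-1)^l], [gterm l] is [z^l] times the [l]-th derivative of [(1 + z)^(-2a)],
    which multiplies the [N]-th coefficient by the falling factorial of [N]. That factorial vanishes
    for [N < l], in agreement with the shift by [l]. *)
Lemma hsum_gterm l z : normc z < 1 ->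
  hsum (fun N => bcoef (2%:R * a) N * ((-1) ^+ l * falling N%:R l) * z ^+ N) (gterm l z).
Proof.
move=> z1.
have h := hsumMl (rising (2%:R * a) l * z ^+ l)
  (hsum_binomial (2%:R * a + l%:R) z1).
apply: eq_hsum (hsum_shift l h) => [N|]; last first.
  by rewrite /gterm opprD mulNr mulrAC.
rewrite falling_nat; case: ltnP => Nl; first by rewrite ffact_small// !mulr0 mul0r.
have [n ->] : exists n, N = (l + n)%N by exists (N - l)%N; rewrite subnKC.
rewrite addKn /bcoef risingD !exprD.
have -> : ((l + n) ^_ l)%:R = (l + n)`!%:R / n`!%:R :> C.
  apply: (mulIf (fact_neq0 C n)); rewrite divfK ?fact_neq0// -natrM.
  by have := ffact_fact (leq_addr n l); rewrite addKn => ->.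
have s : (-1) ^+ l * (-1) ^+ l = 1 :> C by rewrite -exprMn mulrNN mulr1 expr1n.
transitivity (rising (2%:R * a) l * rising (2%:R * a + l%:R) n * (-1) ^+ n / n`!%:R *
  (z ^+ l * z ^+ n) * ((-1) ^+ l * (-1) ^+ l)); first by rewrite s mulr1; ring.
by field; rewrite !fact_neq0.
Qed.

Lemma hsum_closed_form z : normc z < 1 ->
  hsum (fun j => hyp2F1_coef a (a + 1 / 2%:R) (1 / 2%:R - m%:R) j * (z ^+ 2) ^+ j)
    (closed_form z).
Proof.
move=> z1; have z1' : normc (- z) < 1 by rewrite normc_opp.
have h : hsum (fun N => prefactor * \sum_(0 <= k < m.+1) weight k *
    \sum_(0 <= l < k.+1) qcoef _ k l *
     (bcoef (2%:R * a) N * ((-1) ^+ l * falling N%:R l) * z ^+ N +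
      bcoef (2%:R * a) N * ((-1) ^+ l * falling N%:R l) * (- z) ^+ N)) (closed_form z).
  apply: hsumMl; apply: hsum_sum => k _; apply: hsumMl; apply: hsum_sum => l _.
  by apply: hsumMl; apply: hsumD; exact: hsum_gterm.
(* The sums over [l] and [k] are evaluated at [y = N]; the factor [1 + (-1)^N] then removes the odd
   powers. *)
have hE N : prefactor * (\sum_(0 <= k < m.+1) weight k *
    \sum_(0 <= l < k.+1) qcoef _ k l *
     (bcoef (2%:R * a) N * ((-1) ^+ l * falling N%:R l) * z ^+ N +
      bcoef (2%:R * a) N * ((-1) ^+ l * falling N%:R l) * (- z) ^+ N)) =
   prefactor * (4%:R ^+ m / m`!%:R * rising ((1 - N%:R) / 2%:R) m) *
     (bcoef (2%:R * a) N * (1 + (-1) ^+ N) * z ^+ N).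
  rewrite -sum_bin_rising -mulrA mulr_suml; congr (_ * _); apply: eq_bigr => k _.
  rewrite -sum_qcoef -[RHS]mulrA; congr (_ * _); rewrite mulr_suml; apply: eq_bigr => l _.
  by rewrite [(- z) ^+ N]exprNn; ring.
have {}h := eq_hsum hE erefl h.
apply: eq_hsum (hsum_even _ h) => // [j|N oN]; last first.
  by rewrite -signr_odd oN expr1 subrr mulr0 mul0r mulr0.
rewrite hyp2F1_coef_half /prefactor /bcoef -mul2n exprM sqrrN !expr1n.
rewrite exprS -exprM; have -> : 4%:R ^+ m = 2%:R ^+ m * 2%:R ^+ m :> C.
  by rewrite -exprMn -natrM.
by field; rewrite !fact_neq0 odd_dfact_neq0 expf_neq0// pnatr_eq0.
Qed.

Lemma slit_left z : z \notin `]-oo, (-1)] -> ~~ (1 + z <= 0).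
Proof. by rewrite in_itv/= addrC -lerBrDr sub0r. Qed.

Lemma slit_right z : z \notin `[1, +oo[ -> ~~ (1 - z <= 0).
Proof. by rewrite in_itv/= andbT subr_le0. Qed.

Lemma analytic_psum_opp z : analytic_psum (fun y : C => - y) z.
Proof.
have -> : (fun y : C => - y) = (fun y => -1 * y) by apply/funext => y; rewrite mulN1r.
apply: analytic_psumM; [exact: analytic_psum_cst|exact: analytic_psum_id].
Qed.

Lemma analytic_psum_gterm l z : ~~ (1 + z <= 0) -> analytic_psum (gterm l) z.
Proof.
move=> hz; apply: analytic_psumM; last first.
  by apply: analytic_psumX; exact: analytic_psum_id.
apply: analytic_psumM; first exact: analytic_psum_cst.
apply: (analytic_psum_comp (f := fun w => cpow w _) (g := fun y => 1 + y)).
  exact: analytic_psum_cpow.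
by apply: analytic_psumD; [exact: analytic_psum_cst|exact: analytic_psum_id].
Qed.

Lemma analytic_psum_closed_form z : z \notin `]-oo, (-1)] -> z \notin `[1, +oo[ ->
  analytic_psum closed_form z.
Proof.
move=> /slit_left z1 /slit_right z2.
apply: analytic_psumM; first exact: analytic_psum_cst.
apply: analytic_psum_sum => k _; apply: analytic_psumM; first exact: analytic_psum_cst.
apply: analytic_psum_sum => l _; apply: analytic_psumM; first exact: analytic_psum_cst.
apply: analytic_psumD; first exact: analytic_psum_gterm.
apply: (analytic_psum_comp (f := gterm l) (g := fun y => - y)).
  exact: analytic_psum_gterm.
exact: analytic_psum_opp.
Qed.

Lemma sqr_slit z : z \notin `]-oo, (-1)] -> z \notin `[1, +oo[ -> z ^+ 2 \notin `[1, +oo[.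
Proof.
rewrite !in_itv/= !andbT => z1 z2; apply/negP; move: z1 z2; case: z => x y.
rewrite expr2 !lecE /= oppr0 => z1 z2 /andP[/eqP xy xx].
(* A real square has [x y = 0], and [x = 0] would make it [- y^2], which is not at least 1. *)
have y0 : y = 0.
  apply/eqP; move: xy => /eqP; rewrite [y * x]mulrC -mulr2n mulrn_eq0 mulf_eq0 /=.
  case/orP => // /eqP x0; move: xx; rewrite x0 mul0r sub0r => h.
  by have := sqr_ge0 y; rewrite expr2 -oppr_le0 => /(le_trans h); rewrite ler10.
move: z1 z2 xx; rewrite y0 !eqxx/= -!ltNge => z1 z2; rewrite mulr0 subr0.
by apply/negP; rewrite -ltNge; nra.
Qed.

Lemma slit_sqr z : z ^+ 2 \notin `[1, +oo[ ->
  z \notin `]-oo, (-1)] /\ z \notin `[1, +oo[.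
Proof.
rewrite !in_itv/= !andbT => h; split; apply: contra h => h; last exact: exprn_ege1.
by rewrite -sqrrN exprn_ege1// lerNr.
Qed.

(** [sqrtc] jumps across its cut, so it is never treated as analytic: near each [w != 0] evenness
    lets an analytic branch [zeta] replace it. *)
Lemma is_hyp2F1_closed_form :
  is_hyp2F1 (a : C) (a + 1 / 2%:R) (1 / 2%:R - m%:R) (fun w => closed_form (sqrtc w)).
Proof.
have ser w : normc w < 1 ->
    hsum (fun j => hyp2F1_coef a (a + 1 / 2%:R) (1 / 2%:R - m%:R) j * w ^+ j)
      (closed_form (sqrtc w)).
  move=> w1; rewrite -{1}(sqr_sqrtc w); apply: hsum_closed_form.
  by rewrite -(ltr_pXn2r (n := 2))// ?nnegrE ?normc_ge0// expr1n -normcX sqr_sqrtc.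
split=> [w|w wN].
  by rewrite normr_normc -[1]/(1%:C) ltcR => /ser[].
(* No branch of the root is analytic at 0; there the hypergeometric series itself is the
   expansion. *)
have [->|w0] := eqVneq w 0.
  exists (hyp2F1_coef a (a + 1 / 2%:R) (1 / 2%:R - m%:R)); apply/nearcP; exists 1 => // y.
  by rewrite subr0 => /ser[].
have [z1 z2] : sqrtc w \notin `]-oo, (-1)] /\ sqrtc w \notin `[1, +oo[.
  by apply: slit_sqr; rewrite sqr_sqrtc.
apply: analytic_psumP.
pose zeta y : C := sqrtc w * cpow (1 + (w^-1 * y + -1)) 2%:R^-1.
have zw : zeta w = sqrtc w by rewrite /zeta mulVf// subrr addr0 cpow1 mulr1.
(* The radius [|w| / 2] keeps [w + t] away from 0, where [cpow_half_sqr] would not apply. *)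
apply: (@analytic_psum_ext _ (fun y => closed_form (zeta y)) _ _ (normc w / 2%:R)).
- by rewrite divr_gt0// normc_gt0.
- move=> t tw; apply: closed_form_sqr; rewrite sqr_sqrtc /zeta exprMn sqr_sqrtc.
  have y0 : w + t != 0.
    apply/eqP => h; have : normc w <= normc w / 2%:R.
      by rewrite -[in leLHS]normc_opp -[- w]addr0 -h addKr.
    by rewrite ler_pdivlMr// ger_pMr ?normc_gt0// lern1.
  have e : 1 + (w^-1 * (w + t) + -1) = w^-1 * (w + t) by rewrite addrC subrK.
  by rewrite e cpow_half_sqr ?mulVKf// mulf_neq0// invr_eq0.
apply: (analytic_psum_comp (f := closed_form) (g := zeta)).
  by rewrite zw; exact: analytic_psum_closed_form.
apply: analytic_psumM; first exact: analytic_psum_cst.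
apply: (analytic_psum_comp (f := fun v => cpow (1 + v) _) (g := fun y => w^-1 * y + -1)).
  by rewrite mulVf// subrr; exact: analytic_psum_cpow1.
apply: analytic_psumD; last exact: analytic_psum_cst.
by apply: analytic_psumM; [exact: analytic_psum_cst|exact: analytic_psum_id].
Qed.

End ClosedForm.

Theorem theorem2p4 (R : realType) (m : nat) (a z : R[i])
    (hz1 : z \notin `]-oo, (-1)%R]) (hz2 : z \notin `[1%R, +oo[) :
  hyp2F1 a (a + 1 / 2%:R) (1 / 2%:R - m%:R) (z ^+ 2) =
  1 / 2%:R ^+ m.+1 * (m`!%:R / (odd_dfact m)%:R) *
  \sum_(0 <= k < m.+1)
    2%:R ^+ k / k`!%:R * 'C(2 * m - 2 * k, m - k)%:R *
    \sum_(0 <= l < k.+1)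
      (odd_dfact (k - l))%:R *
      ebinom ((2 * k%:Z - l%:Z - 1)%:~R) (l%:Z - 1) *
      (rising (2%:R * a) l * cpow (1 + z) (- 2%:R * a - l%:R) +
       falling (- 2%:R * a) l * cpow (1 - z) (- 2%:R * a - l%:R)) *
      z ^+ l.
Proof.
rewrite (hyp2F1_unique (is_hyp2F1_closed_form m a)); last exact: sqr_slit.
(* The root of [z ^+ 2] chosen by [sqrtc] may be [- z]; evenness makes this harmless. *)
rewrite (closed_form_sqr m a (w := z)) ?sqr_sqrtc// /closed_form.
congr (_ * _); apply: eq_bigr => k _; congr (_ * _).
apply: eq_big_nat => l /andP[_ lk]; rewrite -qcoefE// -[RHS]mulrA; congr (_ * _).
have -> : falling (- 2%:R * a) l = (-1) ^+ l * rising (2%:R * a) l.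
  by rewrite mulNr falling_rising.
by rewrite /gterm [(- z) ^+ l]exprNn; ring.
Qed.
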